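(* Let $\alpha$ be an integer with $0\le \alpha\le 50$ and let $n\ge 1$ be an integer. Then the generalised Laguerre polynomial $L_n^{(\alpha)}(x)$ is irreducible over $\mathbb{Q}$, except when $n=2$ and $\alpha\in\{2,7,14,23,34,47\}$, or $n=4$ and $\alpha\in\{5,23\}$; in each of these exceptional cases $L_n^{(\alpha)}(x)$ has a linear factor over $\mathbb{Q}$.
   Context: For real $\alpha$ and an integer $n\ge 1$, the generalised Laguerre polynomial of degree $n$ is $L_n^{(\alpha)}(x)=\sum_{j=0}^{n}\frac{(n+\alpha)(n-1+\alpha)\cdots(j+1+\alpha)}{(n-j)!\,j!}(-x)^j$ (for $j=n$ the empty product equals $1$). *)

(* Defs.v *)
From HB Require Import structures.
From mathcomp Require Import all_boot all_order all_algebra.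
Set Implicit Arguments. Unset Strict Implicit. Unset Printing Implicit Defensive.
Import Order.TTheory GRing.Theory Num.Theory.
Local Open Scope ring_scope.

Definition laguerre (n : nat) (a : int) : {poly rat} :=
  \poly_(j < n.+1)
    ((\prod_(j.+1 <= i < n.+1) ((i%:Z + a)%:~R : rat))
       / (((n - j)`! * j`!)%:R) * (-1) ^+ j).

Definition laguerre_exceptional (n : nat) (a : int) : Prop :=
  (n = 2%N /\ a \in [:: 2; 7; 14; 23; 34; 47]%Z) \/
  (n = 4%N /\ a \in [:: 5; 23]%Z).

(* Main.v *)
(** Put F = n! L_n^(al), an integral polynomial with leading coefficient 1 or -1, and let k be
    the degree of a factor of F, with 2k <= n.  For a prime p the vertices of the Newton polygon of
    F at p are sums of vertices of those of the two factors.

    If q = p^m satisfies al + (n mod q) < q, then the sides of slopes v_p((p^t)!)/p^t, t >= m,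
    which have denominators p^t, together cover n - (n mod q) of the n roots, as for the truncated
    exponential series.  Hence k mod q <= n mod q.  So for q = p^m to contribute a carry to the
    binomial coefficient C(n, k), q must divide one of n + 1, ..., n + al, and q < al + k.
    Therefore C(n, k) divides both (n + 1) ... (n + al) and lcm(1, ..., al + k - 1), which bounds
    n when k >= 10; the remaining n are excluded by a few primes.

    If k <= 9, all prime powers dividing n - i, i < k, are at most max(k, al + i).  If moreover p
    divides (n - i) or (n + al - i) for some i < k and all slopes at p are less than 1/k, there is
    no factor of degree k.  This leaves n = 2^a 3^b 5^c 7^d with small exponents, and among these
    25 cases with k > 1, each excluded by one side of a Newton polygon, and 54 cases with k = 1, of
    which all but the 8 exceptions have no root modulo a suitable prime. *)
From Stdlib Require Import NArith.
Require Import Defs.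
From HB Require Import structures.
From mathcomp Require Import all_boot all_order all_algebra.
From mathcomp Require Import zify ring.
Import Order.TTheory GRing.Theory Num.Theory.
Local Open Scope ring_scope.

Set Implicit Arguments. Unset Strict Implicit. Unset Printing Implicit Defensive.

(** * Newton polygons of products *)

Section NewtonPolygon.
Local Open Scope nat_scope.
Local Notation "F # j" := (F`_j)%R (at level 2, left associativity).
Variable p : nat.
Hypothesis p_pr : prime p.

(** Minimising this over j locates the points of the Newton polygon on its supporting line of slope
    -a/b. Since [logn p 0 = 0], zero coefficients would look light, so [vtx] and [npmin] range over
    nonzero ones only. *)
Definition wt (a b : nat) (F : {poly int}) (j : nat) : nat :=
  b * logn p `|F # j| + a * j.

(** A strict minimum is the only point on the supporting line, hence a vertex; [npmin] also admits
    the points of a whole side. *)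
Definition vtx a b (F : {poly int}) l :=
  F # l != 0%R /\
  forall j, F # j != 0%R -> j != l -> wt a b F l < wt a b F j.

Definition npmin a b (F : {poly int}) l :=
  F # l != 0%R /\ forall j, F # j != 0%R -> wt a b F l <= wt a b F j.

Lemma dvdz_pfactor m (c : int) : c != 0%R ->
  ((p ^ m)%N%:Z %| c)%Z = (m <= logn p `|c|).
Proof. by move=> c0; rewrite dvdzE absz_nat pfactor_dvdn // absz_gt0. Qed.

Lemma logn_abszM (c d : int) : c != 0%R -> d != 0%R ->
  logn p `|(c * d)%R| = logn p `|c| + logn p `|d|.
Proof. by move=> c0 d0; rewrite abszM lognM ?absz_gt0. Qed.

(** The product of the coefficients at l and l' is strictly the lightest term of the convolution, so
    no other term can cancel it. *)
Lemma vtxM a b (G H : {poly int}) l l' :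
  vtx a b G l -> vtx a b H l' -> vtx a b (G * H)%R (l + l').
Proof.
move=> [Gl Gmin] [Hl' Hmin].
set e := logn p `|G # l| + logn p `|H # l'|.
have term i j : G # i != 0%R -> H # j != 0%R -> ~~ ((i == l) && (j == l')) ->
    b * e + a * (l + l') < b * (logn p `|G # i| + logn p `|H # j|) + a * (i + j).
  move=> Gi Hj; have := Gmin i Gi; have := Hmin j Hj; rewrite /wt /e.
  case: (eqVneq i l) => [->|_]; case: (eqVneq j l') => [->|_] //=;
    rewrite ?mulnDr => // h1 h2 _.
  - have := h1 isT; lia.
  - have := h2 isT; lia.
  - have := h1 isT; have := h2 isT; lia.
have big_dvd m j (P : pred 'I_j.+1) :
    (forall i : 'I_j.+1, P i -> G # i != 0%R -> H # (j - i)%N != 0%R ->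
       m < logn p `|G # i| + logn p `|H # (j - i)%N|) ->
    ((p ^ m.+1)%N%:Z %| (\sum_(i < j.+1 | P i) G # i * H # (j - i)%N)%R)%Z.
  move=> hyp; apply: rpred_sum => i Pi.
  have [->|Gi] := eqVneq G # i 0%R; first by rewrite mul0r dvdz0.
  have [->|Hj] := eqVneq H # (j - i)%N 0%R; first by rewrite mulr0 dvdz0.
  change ((p ^ m.+1)%N%:Z %| (G # i * H # (j - i)%N)%R)%Z.
  by rewrite dvdz_pfactor ?mulf_neq0 // logn_abszM // hyp.
have lo : l < (l + l').+1 by rewrite ltnS leq_addr.
pose ol := Ordinal lo.
have main : ((p ^ e.+1)%N%:Z %| ((G * H)%R # (l + l')%N - G # l * H # l')%R)%Z.
  rewrite coefM (bigD1 ol) //= addKn [X in (_ %| X)%Z]addrC addKr.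
  apply: big_dvd => i nil Gi Hi.
  have ij : i + (l + l' - i) = l + l' by rewrite subnKC // -ltnS.
  have := term i _ Gi Hi; rewrite ij.
  have -> : (val i == l) = false by apply/negbTE; apply: contra nil => /eqP il; apply/eqP/val_inj.
  move=> /(_ isT); rewrite ltn_add2r ltn_mul2l => /andP[] //.
have GHl : (G # l * H # l')%R != 0%R by rewrite mulf_neq0.
have elog : logn p `|(G # l * H # l')%R| = e by rewrite logn_abszM.
have ndvd : ~~ ((p ^ e.+1)%N%:Z %| (G * H)%R # (l + l')%N)%Z.
  apply/negP => h; have : ((p ^ e.+1)%N%:Z %| (G # l * H # l')%R)%Z.
    have -> : (G # l * H # l' = (G * H)%R # (l + l')%N - ((G * H)%R # (l + l')%N - G # l * H # l'))%R.
      by rewrite opprB addrC subrK.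
    exact: rpredB h main.
  by rewrite dvdz_pfactor // elog ltnn.
have GHn0 : (G * H)%R # (l + l')%N != 0%R.
  by apply: contra ndvd => /eqP ->; rewrite dvdz0.
have GHlog : logn p `|(G * H)%R # (l + l')%N| = e.
  apply/eqP; rewrite eqn_leq; apply/andP; split.
    by rewrite leqNgt -dvdz_pfactor.
  rewrite -dvdz_pfactor //.
  have -> : ((G * H)%R # (l + l')%N = ((G * H)%R # (l + l')%N - G # l * H # l') + G # l * H # l')%R.
    by rewrite subrK.
  apply: rpredD; last by change ((p ^ e)%N%:Z %| (G # l * H # l')%R)%Z; rewrite dvdz_pfactor // elog.
  apply: dvdz_trans main; rewrite dvdzE !absz_nat; exact: dvdn_exp2l.
split=> // j GHj jne; rewrite /wt GHlog.
(* If j were no heavier, every product contributing to coefficient j would have a valuation above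
   that of their sum. *)
rewrite ltnNge; apply/negP => le.
have : ((p ^ (logn p `|(G * H)%R # j|).+1)%N%:Z %| (G * H)%R # j)%Z.
  rewrite [X in (_ %| X)%Z]coefM; apply: big_dvd => i _ Gi Hi.
  have ij : i + (j - i) = j by rewrite subnKC // -ltnS.
  have := term i _ Gi Hi; rewrite ij.
  have -> : (val i == l) && (j - i == l') = false.
    by apply/negbTE; apply: contra jne => /andP[/eqP il /eqP jl]; rewrite -ij jl /= il.
  move=> /(_ isT) /(leq_ltn_trans le); rewrite ltn_add2r ltn_mul2l => /andP[] //.
by rewrite dvdz_pfactor // ltnn.
Qed.

Lemma vtx_uniq a b F l l' : vtx a b F l -> vtx a b F l' -> l = l'.
Proof.
move=> [Fl hl] [Fl' hl']; apply/eqP; apply: contraT => ne.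
have := hl _ Fl'; rewrite eq_sym => /(_ ne) h1.
by have := ltn_trans h1 (hl' _ Fl ne); rewrite ltnn.
Qed.

Lemma coef_neq0_size (F : {poly int}) j : F # j != 0%R -> j < size F.
Proof. by move=> h; rewrite ltnNge; apply: contra h => /leq_sizeP ->. Qed.

Lemma npmin_ex a b (F : {poly int}) : F != 0%R -> exists l, npmin a b F l.
Proof.
move=> F0; have lt : (size F).-1 < size F by rewrite prednK // size_poly_gt0.
have Fl : (fun i : 'I_(size F) => F # i != 0%R) (Ordinal lt).
  by rewrite /= -lead_coefE lead_coef_eq0.
case: (@arg_minnP _ (Ordinal lt) (fun i : 'I_(size F) => F # i != 0%R)
  (fun i : 'I_(size F) => wt a b F i) Fl) => i Fi hi.
exists i; split=> // j Fj; have js := coef_neq0_size Fj.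
exact: (hi (Ordinal js)).
Qed.

(* The weights of distinct indices below N are distinct modulo N. *)
Lemma vtx_ex N a b (F : {poly int}) : F != 0%R -> size F <= N -> N %| b ->
  coprime N a -> exists l, vtx a b F l.
Proof.
move=> F0 sF Nb Na; have [l [Fl hl]] := npmin_ex a b F0.
exists l; split=> // j Fj jl; rewrite ltn_neqAle hl // andbT.
apply: contra jl => /eqP; rewrite /wt => e.
have : a * l = a * j %[mod N].
  case/dvdnP: Nb => c bE; have := congr1 (modn^~ N) e.
  by rewrite bE ![c * N * _]mulnAC !modnMDl.
have lj := leq_trans (coef_neq0_size Fl) sF; have jN := leq_trans (coef_neq0_size Fj) sF.
move=> /eqP; wlog le : l j {Fl hl Fj e} lj jN / l <= j => [th|].
  by case: (leqP l j) => [/th|/ltnW /th]; last rewrite eq_sym [_ == l]eq_sym; apply.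
rewrite eq_sym eqn_mod_dvd ?leq_mul2l ?le ?orbT // -mulnBr Gauss_dvdr //.
move=> /dvdn_leq; rewrite subn_gt0; case: ltngtP le => //; lia.
Qed.
(** The new weight is N [wt] + j; as all indices are below N, it compares by [wt] first and breaks
    ties towards the smaller index. *)
Lemma vtx_lo N a b (F : {poly int}) l : size F <= N ->
  vtx (N * a).+1 (N * b) F l ->
  npmin a b F l /\ forall j, npmin a b F j -> l <= j.
Proof.
move=> sF [Fl hl]; split=> [|j [Fj hj]].
  split=> // j Fj; have [-> //|jl] := eqVneq j l.
  have := hl j Fj jl; rewrite /wt => h.
  have lN := leq_trans (coef_neq0_size Fl) sF; have jN := leq_trans (coef_neq0_size Fj) sF.
  rewrite leqNgt; apply/negP => h2; have h3 : N * (b * logn p `|F # j| + a * j).+1 <= N * (b * logn p `|F # l| + a * l).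
    by rewrite leq_mul2l h2 orbT.
  nia.
have [-> //|jl] := eqVneq j l.
have := hl j Fj jl; have := hj l Fl; rewrite /wt => h1 h2.
have h3 : N * (b * logn p `|F # j| + a * j) <= N * (b * logn p `|F # l| + a * l).
  by rewrite leq_mul2l h1 orbT.
nia.
Qed.

(** Here N [wt] - j breaks ties towards the larger index. *)
Lemma vtx_hi N a b (F : {poly int}) r : 0 < N -> 0 < a -> size F <= N ->
  vtx (N * a).-1 (N * b) F r ->
  npmin a b F r /\ forall j, npmin a b F j -> j <= r.
Proof.
move=> N0 a0 sF [Fl hl]; have Na0 : 0 < N * a by rewrite muln_gt0 N0.
split=> [|j [Fj hj]].
  split=> // j Fj; have [-> //|jl] := eqVneq j r.
  have := hl j Fj jl; rewrite /wt => h.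
  have lN := leq_trans (coef_neq0_size Fl) sF; have jN := leq_trans (coef_neq0_size Fj) sF.
  rewrite leqNgt; apply/negP => h2; have h3 : N * (b * logn p `|F # j| + a * j).+1 <= N * (b * logn p `|F # r| + a * r).
    by rewrite leq_mul2l h2 orbT.
  nia.
have [-> //|jl] := eqVneq j r.
have := hl j Fj jl; have := hj r Fl; rewrite /wt => h1 h2.
have h3 : N * (b * logn p `|F # j| + a * j) <= N * (b * logn p `|F # r| + a * r).
  by rewrite leq_mul2l h1 orbT.
nia.
Qed.

(** Equal weights at l and r make a (r - l) a multiple of b, and a is prime to b. *)
Lemma npmin_dvd a b (F : {poly int}) l r : coprime a b ->
  npmin a b F l -> npmin a b F r -> l <= r -> b %| r - l.
Proof.
move=> ab [Fl hl] [Fr hr] lr.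
have e : wt a b F l = wt a b F r by apply/eqP; rewrite eqn_leq hl // hr.
have : b %| a * (r - l).
  have -> : a * (r - l) = b * logn p `|F # l| - b * logn p `|F # r|.
    by move: e; rewrite /wt => e; rewrite mulnBr; have := leq_mul (leqnn a) lr; lia.
  by rewrite -mulnBr dvdn_mulr.
by rewrite Gauss_dvdr // coprime_sym.
Qed.

(** Convexity: the steeper the descent, the further left its side. *)
Lemma npmin_slope a b a' b' (F : {poly int}) r l :
  a' * b < a * b' -> npmin a b F r -> npmin a' b' F l -> r <= l.
Proof.
move=> slope [Fr hr] [Fl hl]; rewrite leqNgt; apply/negP => lr.
have := hr l Fl; have := hl r Fr; rewrite /wt.
set y := logn p _; set x := logn p _ => h1 h2.
have h1' : b * (b' * y + a' * l) <= b * (b' * x + a' * r) by rewrite leq_mul2l h1 orbT.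
have h2' : b' * (b * x + a * r) <= b' * (b * y + a * l) by rewrite leq_mul2l h2 orbT.
have : (a' * b).+1 * (r - l) <= a * b' * (r - l) by rewrite leq_mul2r slope orbT.
nia.
Qed.

(* Perturbing the slope by 1/N, with N above the degrees, isolates each end of the side. *)
Lemma factor_side a b (G H : {poly int}) l r :
  (G * H)%R != 0%R -> 0 < a -> coprime a b ->
  npmin a b (G * H)%R l -> npmin a b (G * H)%R r ->
  exists lG rG lH rH, [/\ npmin a b G lG, npmin a b G rG, npmin a b H lH & npmin a b H rH]
   /\ [/\ lG + lH <= l, r <= rG + rH, lG <= rG /\ lH <= rH, b %| rG - lG & b %| rH - lH].
Proof.
move=> GH0 a0 ab ml mr.
have [G0 H0] : G != 0%R /\ H != 0%R by move: GH0; rewrite mulf_eq0 negb_or => /andP.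
pose N := (size G + size H + size (G * H)%R).+1.
have sG : size G <= N by rewrite /N; lia.
have sH : size H <= N by rewrite /N; lia.
have sGH : size (G * H)%R <= N by rewrite /N; lia.
have cp1 : coprime N (N * a).+1.
  exact: coprime_dvdl (dvdn_mulr a (dvdnn N)) (coprimenS _).
have cp2 : coprime N (N * a).-1.
  apply: coprime_dvdl (dvdn_mulr a (dvdnn N)) _.
  by rewrite coprime_sym; apply: coprimePn; rewrite muln_gt0 a0.
have [lG vlG] := vtx_ex G0 sG (dvdn_mulr b (dvdnn N)) cp1.
have [lH vlH] := vtx_ex H0 sH (dvdn_mulr b (dvdnn N)) cp1.
have [rG vrG] := vtx_ex G0 sG (dvdn_mulr b (dvdnn N)) cp2.
have [rH vrH] := vtx_ex H0 sH (dvdn_mulr b (dvdnn N)) cp2.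
have [_ hl] := vtx_lo sGH (vtxM vlG vlH).
have [_ hr] := vtx_hi (ltn0Sn _) a0 sGH (vtxM vrG vrH).
have [mlG _] := vtx_lo sG vlG; have [mlH _] := vtx_lo sH vlH.
have [mrG hrG] := vtx_hi (ltn0Sn _) a0 sG vrG; have [mrH hrH] := vtx_hi (ltn0Sn _) a0 sH vrH.
exists lG, rG, lH, rH; split=> //; split.
- exact: hl.
- exact: hr.
- by split; [apply: hrG | apply: hrH].
- by apply: (npmin_dvd ab mlG mrG); apply: hrG.
- by apply: (npmin_dvd ab mlH mrH); apply: hrH.
Qed.

(** The side from l to r splits between G and H into pieces of length divisible by b, and at most n
    - (r - l) < b of the degree of G lies outside its piece. *)
Lemma single_side a b (G H : {poly int}) n k l r :
  (G * H)%R != 0%R -> 0 < a -> coprime a b ->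
  size G = k.+1 -> size H = (n - k).+1 -> k <= n ->
  npmin a b (G * H)%R l -> npmin a b (G * H)%R r -> l <= r <= n ->
  n - (r - l) < b -> k %% b <= n - (r - l).
Proof.
move=> GH0 a0 ab sG sH kn ml mr /andP[lr rn] nb.
have [lG [rG [lH [rH [[mlG mrG mlH mrH] [h1 h2 [h3 h4] /dvdnP[x hx] /dvdnP[y hy]]]]]]] :=
  factor_side GH0 a0 ab ml mr.
have := coef_neq0_size (proj1 mrG); have := coef_neq0_size (proj1 mrH).
rewrite sG sH !ltnS => rHn rGk.
have -> : k = x * b + (k - x * b) by lia.
rewrite modnMDl modn_small; lia.
Qed.

(* The lower edge of slope < 1/k through the constant term leaves no room for a
   factor of degree k, unless its constant term is prime to p. *)
Lemma small_slope (G H : {poly int}) n k :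
  size G = k.+1 -> size H = (n - k).+1 -> 0 < k <= n -> `|lead_coef G| = 1%N ->
  logn p `|(G * H)%R # n| = 0 ->
  (G * H)%R # 0 != 0%R ->
  (forall j, j <= n - k -> p %| `|(G * H)%R # j|) ->
  (forall j, 0 < j -> (G * H)%R # j != 0%R ->
     k * logn p `|(G * H)%R # 0| < k * logn p `|(G * H)%R # j| + j) -> False.
Proof.
move=> sG sH /andP[k0 kn] leadG leadF F0 pF slope.
have G0 : G != 0%R by rewrite -size_poly_eq0 sG.
have H0 : H != 0%R by rewrite -size_poly_eq0 sH.
have sF : size (G * H)%R = n.+1 by rewrite size_mul // sG sH addSn addnS subnKC.
pose N := n.+2.
have Gk : G # k != 0%R by have := lead_coef_eq0 G; rewrite lead_coefE sG /= (negPf G0) => ->.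
have Gk1 : logn p `|G # k| = 0 by move: leadG; rewrite lead_coefE sG /= => ->; rewrite logn1.
have sGN : size G <= N by rewrite sG /N; lia.
have sHN : size H <= N by rewrite sH /N; lia.
(* The slope (N - 1)/(N k) is just below 1/k; as all indices are below N, the constant term is still
   the strict minimum. *)
have vF : vtx N.-1 (N * k) (G * H)%R 0.
  split=> // j Fj j0; have jn := coef_neq0_size Fj; rewrite sF in jn.
  have := slope j; rewrite lt0n => /(_ j0 Fj); rewrite /wt /N /= => h.
  have : N * (k * logn p `|(G * H)%R # 0|).+1 <= N * (k * logn p `|(G * H)%R # j| + j) by rewrite leq_mul2l h orbT.
  rewrite /N; nia.
have cp : coprime N N.-1 by rewrite /N /= coprimeSn.
have [lG vG] := vtx_ex G0 sGN (dvdn_mulr k (dvdnn N)) cp.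
have [lH vH] := vtx_ex H0 sHN (dvdn_mulr k (dvdnn N)) cp.
have := vtx_uniq (vtxM vG vH) vF => /eqP; rewrite addn_eq0 => /andP[/eqP lG0 _].
rewrite lG0 in vG; have [G00 /(_ k Gk)] := vG; rewrite -lt0n => /(_ k0).
rewrite /wt Gk1 muln0 muln0 add0n addn0 => h.
(* In G the constant term is lighter than the leading coefficient, a unit at index k, which leaves
   room for valuation 0 only. *)
have G0u : logn p `|G # 0| = 0.
  apply/eqP; rewrite -leqn0 leqNgt; apply/negP => h2.
  have : N * k * 1 <= N * k * logn p `|G # 0| by rewrite leq_mul2l h2 orbT.
  rewrite /N /= in h *; nia.
(* At slope 1/N, index 0 is a vertex of G, so the product has a vertex l <= n - k. Its coefficient
   is divisible by p, so its weight is at least N, more than the weight n of the leading term. *)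
have uG : vtx 1 N G 0.
  split=> // j _ j0; rewrite /wt G0u muln0 muln0 !add0n; lia.
have [l uH] := vtx_ex H0 sHN (dvdnn N) (coprimen1 N).
have [Fl /(_ n)] := vtxM uG uH; rewrite add0n => hn.
have ln : l <= n - k by have := coef_neq0_size (proj1 uH); rewrite sH ltnS.
have Fn0 : (G * H)%R # n != 0%R.
  by have := lead_coef_eq0 (G * H)%R; rewrite lead_coefE sF /= mulf_eq0 (negPf G0) (negPf H0) => ->.
have := pF l ln; rewrite -{1}(expn1 p) pfactor_dvdn // ?absz_gt0 // => h1.
have nl : n != l by lia.
have := hn Fn0 nl; rewrite /wt leadF muln0 add0n mul1n mul1n.
have : N * 1 <= N * logn p `|(G * H)%R # l| by rewrite leq_mul2l h1 orbT.
rewrite /N; lia.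
Qed.
End NewtonPolygon.

Local Notation "F # j" := (F`_j)%R (at level 2, left associativity).

(** * The degree of a factor modulo prime powers *)

Section FloorSums.
Local Open Scope nat_scope.
Variables (p al n : nat).
Hypothesis p_pr : prime p.

(* Summed over the powers P = p^x with x > 0, this is v_p((j + al)! j! (n - j)!). *)
Definition fl P j := (j + al) %/ P + j %/ P + (n - j) %/ P.

(** The quotient of n - j loses a borrow and that of j + al gains a carry. Hence P [fl P j] - j
    depends only on j mod P. *)
Lemma flE P j : 0 < P -> j <= n ->
  P * fl P j + P * (n %% P < j %% P) + j %% P =
  j + P * (al %/ P + n %/ P) + P * (P <= j %% P + al %% P).
Proof.
move=> P0 jn; have h1 := leq_div2r P jn; have := divn_eq j P; have := divn_eq n P.
have e1 : (n - j) %/ P = n %/ P - j %/ P - (n %% P < j %% P) by rewrite divnB.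
have e2 : (j + al) %/ P = j %/ P + al %/ P + (P <= j %% P + al %% P) by rewrite divnD.
rewrite /fl e1 e2; clear e1 e2.
have := ltn_pmod j P0; have := ltn_pmod n P0.
set a := j %/ P in h1 *; set b := n %/ P in h1 *; set c := j %% P; set d := n %% P.
move=> h2 h3 h4 h5.
(* This makes the truncated subtraction in [e1] exact. *)
have h6 : a + (d < c) <= b.
  case: ltnP => //= hdc; rewrite ?addn0 ?addn1 //; rewrite ltn_neqAle h1 andbT.
  by apply/eqP => ab; move: jn; rewrite h4 h5 ab leq_add2l leqNgt hdc.
set e := nat_of_bool (d < c) in h6 *; set g := nat_of_bool (P <= _).
have h7 : a + al %/ P + g + a + (b - a - e) + e = a + (al %/ P + b) + g by lia.
by rewrite -mulnDr h7 !mulnDr; lia.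
Qed.

Lemma fl_le_mod P j j' : 0 < P -> j <= n -> j' <= n -> j %% P = j' %% P ->
  P * fl P j + j' <= P * fl P j' + j.
Proof. by move=> P0 jn jn' e; have := flE P0 jn; have := flE P0 jn'; rewrite e; lia. Qed.

(** The borrow at j costs P, which offsets any carry there, while j' has no borrow and a smaller
    residue. *)
Lemma fl_le_gt P j j' : 0 < P -> j <= n -> j' <= n ->
  j' %% P <= n %% P < j %% P -> P * fl P j + j' <= P * fl P j' + j.
Proof.
move=> P0 jn jn' /andP[h1 h2]; have := flE P0 jn; have := flE P0 jn'.
by rewrite h2 ltnNge h1 /= muln0 muln1; case: (P <= _); case: (P <= _); rewrite /= ?muln0 ?muln1; lia.
Qed.

(** A comparison one power p^x at a time. Summed with weight p^t, it says that j' is at least as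
    light as j for slope [slope t] / p^t: each x <= t absorbs the share 1/p^x of that slope. *)
Definition better t j j' := forall x, 0 < x ->
  if x <= t then p ^ x * fl (p ^ x) j + j' <= p ^ x * fl (p ^ x) j' + j
  else fl (p ^ x) j <= fl (p ^ x) j'.

Lemma better_trans t j1 j2 j3 : better t j1 j2 -> better t j2 j3 -> better t j1 j3.
Proof.
move=> h1 h2 x x0; have := h1 x x0; have := h2 x x0; case: ifP => _; last by move=> ? ?; lia.
lia.
Qed.

Let p_gt0 x : 0 < p ^ x. Proof. by rewrite expn_gt0 prime_gt0. Qed.

(* Clearing the top digits (from the position after which subtracting j from n always
   borrows) of n - j can only improve the weight. *)
Lemma better_low t j : j <= n ->
  exists j', [/\ j' <= n, j' %% p ^ t <= n %% p ^ t & better t j j'].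
Proof.
move=> jn; case: (leqP (j %% p ^ t) (n %% p ^ t)) => [h|hjt].
  by exists j; split=> // x x0; case: ifP.
(* The h chosen below is the last position up to t without a borrow; the new index keeps the lowest
   h digits of n - j and clears those from h to t - 1. *)
pose Q h := (h <= t) && (j %% p ^ h <= n %% p ^ h).
have exQ : exists h, Q h by exists 0; rewrite /Q leq0n expn0 !modn1.
have Qt h : Q h -> h <= t by case/andP.
case: (ex_maxnP exQ Qt) => h /andP[ht Qh] hmax.
have {}ht : h < t by rewrite ltn_neqAle ht andbT; apply: contraL Qh => /eqP ->; rewrite -ltnNge.
pose c := (n - j) %% p ^ t; pose c' := (n - j) %% p ^ h; pose D := (n - j) %/ p ^ t.
have njE : n - j = D * p ^ t + c by rewrite -divn_eq.
have c'E : c' = c %% p ^ h by rewrite /c modn_dvdm // dvdn_exp2l // ltnW.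
have c'c : c' <= c by rewrite c'E leq_mod.
have hdvd : p ^ h %| c - c' by rewrite c'E -eqn_mod_dvd ?leq_mod // modn_mod.
exists (j + (c - c')).
have jn' : j + (c - c') <= n.
  rewrite -[leqRHS](subnKC jn) leq_add2l; apply: leq_trans (leq_subr _ _) _.
  exact: leq_mod.
have nj'E : n - (j + (c - c')) = D * p ^ t + c'.
  by rewrite subnDA njE -addnBA ?leq_subr // subKn.
have c'h : c' < p ^ h by rewrite ltn_pmod.
have c'n : c' <= n %% p ^ h.
  by rewrite /c' modnB // ltnNge Qh mul0n add0n leq_subr.
have key x : h < x -> x <= t -> (j + (c - c')) %% p ^ x <= n %% p ^ x < j %% p ^ x.
  move=> hx xt; apply/andP; split; last first.
    by rewrite ltnNge; apply/negP => qx; have := hmax x; rewrite /Q xt qx => /(_ isT); rewrite leqNgt hx.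
  have c'x : c' < p ^ x by apply: leq_trans c'h _; rewrite leq_exp2l ?prime_gt1 // ltnW.
  have e1 : (n - (j + (c - c'))) %% p ^ x = c'.
    rewrite nj'E -modnDml; have /eqP -> : p ^ x %| D * p ^ t by rewrite dvdn_mull // dvdn_exp2l.
    by rewrite add0n modn_small.
  have c'nx : c' <= n %% p ^ x.
    apply: leq_trans c'n _; rewrite -(@modn_dvdm (p ^ x) n (p ^ h)) ?leq_mod //.
    by rewrite dvdn_exp2l // ltnW.
  have -> : j + (c - c') = n - (n - (j + (c - c'))) by rewrite subKn.
  by rewrite modnB ?leq_subr // e1 ltnNge c'nx mul0n add0n leq_subr.
split=> //; first by have /andP[] := key t ht (leqnn t).
move=> x x0; case: ifP => xt.
  case: (leqP x h) => hx.
    apply: fl_le_mod => //; rewrite -modnDmr.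
    have /eqP -> : p ^ x %| c - c' by apply: dvdn_trans hdvd; rewrite dvdn_exp2l.
    by rewrite addn0.
  by apply: fl_le_gt => //; apply: key.
have tx : t <= x by apply: ltnW; rewrite ltnNge xt.
rewrite /fl; have -> : (n - (j + (c - c'))) %/ p ^ x = (n - j) %/ p ^ x.
  have ct : c < p ^ t by rewrite ltn_pmod.
  have c't : c' < p ^ t by apply: leq_ltn_trans ct.
  by rewrite -(subnKC tx) expnD !divnMA nj'E njE !divnMDl // (divn_small ct) (divn_small c't).
by rewrite leq_add2r; apply: leq_add; apply: leq_div2r; rewrite ?leq_add2r leq_addr.
Qed.

(** With neither carry nor borrow at p^t, powers beyond p^t see only the quotient by p^t. There the
    sum is at most twice the quotient of n, and J attains this because it differs from n / p^t at
    most in the last digit. *)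
Lemma better_side t j J : j <= n -> j %% p ^ t <= n %% p ^ t ->
  al + n %% p ^ t < p ^ t -> p * (n %/ p ^ t %/ p) <= J <= n %/ p ^ t ->
  better t j (j %% p ^ t + p ^ t * J).
Proof.
move=> jn jr ar /andP[VJ JN]; set r := j %% p ^ t.
have rp : r < p ^ t by rewrite ltn_pmod.
have jn' : r + p ^ t * J <= n.
  by rewrite [leqRHS](divn_eq n (p ^ t)) addnC mulnC leq_add // leq_mul2r JN orbT.
move=> x x0; case: ifP => xt.
  apply: fl_le_mod => //; rewrite addnC.
  have /eqP h : p ^ x %| p ^ t * J by rewrite dvdn_mulr // dvdn_exp2l.
  by rewrite -[in RHS]modnDml h add0n /r modn_dvdm // dvdn_exp2l.
have tx : t <= x by apply: ltnW; rewrite ltnNge xt.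
have [y [y0 ->]] : exists y, 0 < y /\ x = t + y by exists (x - t); rewrite subnKC // subn_gt0 ltnNge xt.
rewrite /fl expnD !divnMA; set N := n %/ p ^ t; set P := p ^ y.
have P0 : 0 < P by apply: p_gt0.
have q1 j0 : j0 <= n -> j0 %% p ^ t <= n %% p ^ t ->
   (j0 + al) %/ p ^ t = j0 %/ p ^ t /\ (n - j0) %/ p ^ t = N - j0 %/ p ^ t.
  move=> jn0 jr0; split; last by rewrite divnB // ltnNge jr0 subn0.
  rewrite divnD // (divn_small (_ : al < p ^ t)); last by apply: leq_ltn_trans (leq_addr _ _) ar.
  rewrite addn0 leqNgt (_ : _ + _ < _ = true) ?addn0 //.
  rewrite (modn_small (_ : al < p ^ t)); last by apply: leq_ltn_trans (leq_addr _ _) ar.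
  by rewrite addnC; apply: leq_ltn_trans ar; rewrite leq_add2l.
have r' : (r + p ^ t * J) %% p ^ t = r by rewrite addnC mulnC modnMDl modn_small.
have d' : (r + p ^ t * J) %/ p ^ t = J by rewrite addnC mulnC divnMDl // divn_small // addn0.
have [-> ->] := q1 _ jn jr; have [] := q1 _ jn'; first by rewrite r'.
rewrite d' => -> ->; set J0 := j %/ p ^ t.
have J0N : J0 <= N by apply: leq_div2r.
have h1 : J0 %/ P + (N - J0) %/ P <= N %/ P.
  by rewrite -{2}(subnKC J0N) divnD // leq_addr.
have h2 := leq_div2r P J0N.
have h3 : N %/ P <= J %/ P.
  apply: leq_trans (leq_div2r P VJ); rewrite /P -(prednK y0) expnS !divnMA mulKn ?prime_gt0 //.
apply: (@leq_trans (N %/ P + N %/ P)); first by rewrite -addnA leq_add.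
by apply: leq_trans (leq_addr _ _); apply: leq_add.
Qed.
End FloorSums.

(** * The integral polynomial n! L_n^(al) and the sides of its Newton polygons *)

Section LaguerreInt.
Local Open Scope nat_scope.

(** The absolute value of the coefficient of x^j in n! L_n^(al). *)
Definition lcoef n al j := 'C(n, j) * (n + al) ^_ (n - j).

(* n! L_n^(al) *)
Definition lagint n al : {poly int} :=
  (\poly_(j < n.+1) ((-1) ^+ j * (lcoef n al j)%:Z))%R.

Lemma coef_lagint n al j : j <= n -> (lagint n al) # j = ((-1) ^+ j * (lcoef n al j)%:Z)%R.
Proof. by move=> jn; rewrite coef_poly ltnS jn. Qed.

Lemma absz_lagint n al j : j <= n -> `|(lagint n al) # j| = lcoef n al j.
Proof. by move=> jn; rewrite coef_lagint // abszMsign absz_nat. Qed.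

Lemma lcoef_gt0 n al j : j <= n -> 0 < lcoef n al j.
Proof. by move=> jn; rewrite muln_gt0 bin_gt0 jn ffact_gt0; lia. Qed.

Lemma lagint_neq0 n al j : j <= n -> (lagint n al) # j != 0%R.
Proof. by move=> jn; rewrite -absz_gt0 absz_lagint // lcoef_gt0. Qed.

Lemma lagint_le n al j : (lagint n al) # j != 0%R -> j <= n.
Proof. by move=> h; rewrite -ltnS; apply: leq_trans (coef_neq0_size h) (size_poly _ _). Qed.

Lemma size_lagint n al : size (lagint n al) = n.+1.
Proof.
apply/eqP; rewrite eqn_leq size_poly /=.
by apply: coef_neq0_size; apply: lagint_neq0.
Qed.

Lemma lcoefn n al : lcoef n al n = 1.
Proof. by rewrite /lcoef binn subnn ffactn0. Qed.

(** In this form the dependence on j is confined to three factorials, so Legendre's formula turns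
    valuations into the sums of [fl]. *)
Lemma lcoefE n al j : j <= n ->
  lcoef n al j * ((j + al)`! * j`! * (n - j)`!) = n`! * (n + al)`!.
Proof.
move=> jn; rewrite /lcoef -(bin_fact jn) -(@ffact_fact (n + al) (n - j)) //; last by lia.
have -> : n + al - (n - j) = j + al by lia.
by ring.
Qed.

Variable p : nat.
Hypothesis p_pr : prime p.

Lemma logn_lcoef n al j : j <= n ->
  logn p (lcoef n al j) + (logn p (j + al)`! + logn p j`! + logn p (n - j)`!)
   = logn p n`! + logn p (n + al)`!.
Proof.
move=> jn; have := congr1 (logn p) (lcoefE al jn); have := lcoef_gt0 al jn.
by move: (lcoef n al j) => c c0; rewrite !lognM ?muln_gt0 ?fact_gt0.
Qed.

Lemma logn_fact_wide M n : n < M -> logn p n`! = \sum_(1 <= x < M) n %/ p ^ x.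
Proof.
move=> nM; rewrite logn_fact // [RHS](@big_cat_nat _ _ _ n.+1) //=.
rewrite (_ : \sum_(n.+1 <= x < M) n %/ p ^ x = 0) ?addn0 //.
rewrite big_nat_cond big1 // => x /andP[/andP[nx _] _].
by rewrite divn_small //; apply: leq_trans nx _; apply: ltnW; apply: ltn_expl; apply: prime_gt1.
Qed.

(* slope t / p^t = 1/p + ... + 1/p^t = v_p((p^t)!) / p^t *)
Definition slope t := \sum_(1 <= x < t.+1) p ^ (t - x).

Lemma slopeS t : slope t.+1 = (p * slope t).+1.
Proof.
rewrite /slope big_nat_recr //= subnn expn0 addn1; congr _.+1.
by rewrite big_distrr big_nat_cond [RHS]big_nat_cond; apply: eq_bigr => x /andP[/andP[_ xt] _];
  rewrite /= subSn // expnS.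
Qed.

Lemma slope_gt0 t : 0 < t -> 0 < slope t.
Proof. by case: t => // t _; rewrite slopeS. Qed.

(** For t > 0, [slope t] is 1 modulo p, so the denominator of the slope is exactly p^t. *)
Lemma coprime_slope t : coprime (slope t) (p ^ t).
Proof.
case: t => [|t]; first by rewrite coprimen1.
by rewrite coprime_pexpr // slopeS coprime_sym; apply: coprime_dvdl (dvdn_mulr _ (dvdnn p)) (coprimenS _).
Qed.

Lemma slope_lt s t : s < t -> slope s * p ^ t < slope t * p ^ s.
Proof.
elim: t => // t IH; rewrite ltnS leq_eqVlt => /orP[/eqP ->|/IH {}IH]; rewrite slopeS expnS.
  by rewrite mulnCA mulnA ltn_pmul2r ?ltnS ?expn_gt0 ?prime_gt0.
have : p * (slope s * p ^ t) <= p * (slope t * p ^ s) by rewrite leq_mul2l (ltnW IH) orbT.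
have : 0 < p ^ s by rewrite expn_gt0 prime_gt0.
by rewrite mulSn -mulnA (mulnCA (slope s) p); lia.
Qed.

Variables n al : nat.
Local Notation L := (lagint n al).

Lemma better_wt t j j' : j <= n -> j' <= n -> better p al n t j j' ->
  wt p (slope t) (p ^ t) L j' <= wt p (slope t) (p ^ t) L j.
Proof.
move=> jn jn' bt; rewrite /wt !absz_lagint //.
pose V i := logn p (i + al)`! + logn p i`! + logn p (n - i)`!.
(* The valuation of a coefficient is a constant minus V, so lighter indices are those with larger V,
   corrected by the slope. *)
suff : p ^ t * V j + slope t * j' <= p ^ t * V j' + slope t * j.
  have := logn_lcoef al jn; have := logn_lcoef al jn'; rewrite -!/(V _) => e1 e2 h.
  have : p ^ t * (logn p (lcoef n al j) + V j) = p ^ t * (logn p (lcoef n al j') + V j').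
    by rewrite e1 e2.
  by rewrite !mulnDr; lia.
pose M := (n + al + t).+2.
have VE i : i <= n -> V i = \sum_(1 <= x < M) fl al n (p ^ x) i.
  by move=> ni; rewrite /V !(@logn_fact_wide M) ?big_split //= /M; lia.
have sE i : slope t * i = \sum_(1 <= x < M) (if x <= t then p ^ (t - x) * i else 0).
  rewrite /slope big_distrl [RHS](@big_cat_nat _ _ _ t.+1) //=; last by rewrite /M; lia.
  rewrite (_ : \sum_(t.+1 <= x < M) _ = 0) ?addn0; last first.
    by rewrite big_nat_cond big1 // => x /andP[/andP[tx _] _]; rewrite leqNgt tx.
  rewrite big_nat_cond [RHS]big_nat_cond; apply: eq_bigr => x /andP[/andP[_ xt] _].
  by rewrite -ltnS xt.
rewrite !VE // !sE !big_distrr /= -!big_split /=.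
rewrite big_nat_cond [X in _ <= X]big_nat_cond; apply: leq_sum => x /andP[/andP[x0 _] _].
have := bt x x0; case: ifP => xt h; last by rewrite !addn0 leq_mul2l h orbT.
by rewrite -(subnK xt) addnK expnD -!mulnA -!mulnDr leq_mul2l h orbT.
Qed.

(** Any minimiser can be moved by [better_low] to a residue without borrow, and then by
    [better_side] to either end of the range of quotients, without gaining weight. *)
Lemma lagint_side t : 0 < t -> al + n %% p ^ t < p ^ t ->
  exists rho, let N := n %/ p ^ t in
   [/\ rho <= n %% p ^ t, npmin p (slope t) (p ^ t) L (rho + p ^ t * (p * (N %/ p)))
    & npmin p (slope t) (p ^ t) L (rho + p ^ t * N)].
Proof.
move=> t0 ar; have L0 : L != 0%R by rewrite -size_poly_eq0 size_lagint.
have [j0 [Lj0 hj0]] := npmin_ex p (slope t) (p ^ t) L0.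
have j0n := lagint_le Lj0.
have [j1 [j1n j1r b1]] := better_low al p_pr t j0n.
exists (j1 %% p ^ t) => N.
have Nn : n = n %% p ^ t + p ^ t * N by rewrite {1}(divn_eq n (p ^ t)) addnC mulnC.
have main J : p * (N %/ p) <= J <= N -> npmin p (slope t) (p ^ t) L (j1 %% p ^ t + p ^ t * J).
  move=> /andP[h1 h2]; have jn : j1 %% p ^ t + p ^ t * J <= n.
    by rewrite Nn leq_add // leq_mul2l h2 orbT.
  split=> [|j Lj]; first exact: lagint_neq0.
  apply: leq_trans (hj0 j Lj); apply: better_wt => //.
  by apply: (better_trans p_pr b1); apply: better_side => //; rewrite h1.
split=> //; apply: main; rewrite ?leqnn ?andbT mulnC leq_trunc_div //.
Qed.

(** All but n mod q of the roots lie on sides whose lengths in G and in H are multiples of q; so k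
    exceeds some multiple of q by at most n mod q. *)
Theorem mod_prime_power (G H : {poly int}) k m : (G * H)%R = L ->
  size G = k.+1 -> al + n %% p ^ m < p ^ m -> k %% p ^ m <= n %% p ^ m.
Proof.
move=> GH sG; case: m => [|m]; first by rewrite expn0 !modn1.
set q := p ^ m.+1 => alq.
have L0 : L != 0%R by rewrite -size_poly_eq0 size_lagint.
have [G0 H0] : G != 0%R /\ H != 0%R by move: L0; rewrite -GH mulf_eq0 negb_or => /andP.
have sGH : k + size H = n.+1.
  by rewrite -(size_lagint n al) -GH size_mul // sG addSn.
have p1 := prime_gt1 p_pr.
(* X and Y count the roots of G and H on sides of slope (slope s)/p^s, s >= t *)
have chain t : m < t -> exists X Y, [/\ q %| X, q %| Y, p ^ t * (n %/ p ^ t) <= X + Y &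
   forall s l, s < t -> (npmin p (slope s) (p ^ s) G l -> X <= l) /\
                        (npmin p (slope s) (p ^ s) H l -> Y <= l)].
  (* The induction descends from a power of p above n, where X = Y = 0 suffices. *)
  have [T nT] : exists T, n < p ^ (m.+1 + T).
    by exists n; apply: leq_trans (ltn_expl n p1) _; rewrite leq_exp2l // leq_addl.
  have big : exists X Y, [/\ q %| X, q %| Y, p ^ (m.+1 + T) * (n %/ p ^ (m.+1 + T)) <= X + Y &
   forall s l, s < m.+1 + T -> (npmin p (slope s) (p ^ s) G l -> X <= l) /\
                        (npmin p (slope s) (p ^ s) H l -> Y <= l)].
    by exists 0, 0; rewrite divn_small // muln0 !dvdn0.
  move=> mt; have [tT|/ltnW tT] := leqP t (m.+1 + T); last first.
    exists 0, 0; rewrite !dvdn0; split=> //.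
    by rewrite divn_small ?muln0 //; apply: leq_trans nT _; rewrite leq_exp2l.
  elim: T {nT} big tT => [|T IH] big tT.
    by have -> : t = m.+1 + 0 by apply/eqP; rewrite eqn_leq tT addn0.
  have [tT'|tT'] := leqP t (m.+1 + T); last first.
    by have -> : t = m.+1 + T.+1 by apply/eqP; rewrite eqn_leq tT addnS.
  apply: (IH _ tT'); set s := m.+1 + T.
  have [X [Y [qX qY XY bXY]]] := big; rewrite addnS -/s in XY bXY.
  have s0 : 0 < s by [].
  (* The hypothesis passes from q to its multiple p^s: the remainder modulo p^s falls short of p^s
     by at least as much as the remainder modulo q falls short of q. *)
  have als : al + n %% p ^ s < p ^ s.
    have qs : q %| p ^ s by rewrite dvdn_exp2l // leq_addr.
    have e1 : n %% p ^ s = n %% p ^ s %/ q * q + n %% q.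
      by rewrite {1}(divn_eq (n %% p ^ s) q) modn_dvdm.
    have : n %% p ^ s %/ q < p ^ s %/ q.
      by rewrite ltn_divLR ?expn_gt0 ?prime_gt0 // divnK // ltn_pmod // expn_gt0 prime_gt0.
    rewrite -(leq_pmul2r (_ : 0 < q)) ?expn_gt0 ?prime_gt0 // divnK // mulSn => h.
    by rewrite e1; move: alq h; clear; lia.
  have [rho [_ ml mr]] := lagint_side s0 als.
  rewrite -GH in ml mr L0.
  have [lG [rG [lH [rH [[mlG mrG mlH mrH] [h1 h2 [h3 h4] d1 d2]]]]]] :=
    factor_side p_pr L0 (slope_gt0 s0) (coprime_slope s) ml mr.
  have qs : q %| p ^ s by rewrite dvdn_exp2l // leq_addr.
  exists (X + (rG - lG)), (Y + (rH - lH)); split.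
  - by rewrite dvdn_add // (dvdn_trans qs).
  - by rewrite dvdn_add // (dvdn_trans qs).
  - move: XY h1 h2 h3 h4; rewrite expnSr divnMA.
    set N := n %/ p ^ s => XY h1 h2 h3 h4.
    have : p ^ s * p * (N %/ p) <= p ^ s * N.
      by rewrite -mulnA leq_mul2l mulnC leq_trunc_div orbT.
    move: XY h1 h2 h3 h4; rewrite mulnA; clear; lia.
  - move=> s' l s's; have [bG bH] := bXY s lG (ltnSn s); have [_ bH'] := bXY s lH (ltnSn s).
    have sl := slope_lt s's; split=> hl.
      by have := npmin_slope p_pr sl mrG hl; have := bG mlG; move: h3; clear; lia.
    by have := npmin_slope p_pr sl mrH hl; have := bH' mlH; move: h4; clear; lia.
have [X [Y [/dvdnP[x xE] /dvdnP[y yE] XY bXY]]] := chain m.+1 (ltnSn m).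
(* [slope 0] is 0, below all slopes used so far; a minimiser for it lies within the degree, which
   yields X <= k and the like for Y. *)
have sz (F : {poly int}) : F != 0%R -> exists2 l, npmin p (slope 0) (p ^ 0) F l & l < size F.
  by move=> /(npmin_ex p (slope 0) (p ^ 0))[l hl]; exists l => //; apply: coef_neq0_size (proj1 hl).
have [lG mG lGk] := sz G G0; have [lH mH lHk] := sz H H0.
have [/(_ mG) hX _] := bXY 0 lG isT; have [_ /(_ mH) hY] := bXY 0 lH isT.
have e := divn_eq n q; rewrite -/q in XY.
rewrite sG in lGk.
have -> : k = x * q + (k - x * q) by move: xE hX lGk; clear; lia.
have h : k - x * q <= n %% q.
  move: xE yE XY hX hY lGk lHk sGH e; clear; rewrite [q * _]mulnC; lia.
by rewrite modnMDl modn_small //; apply: leq_ltn_trans h _; rewrite ltn_pmod // expn_gt0 prime_gt0.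
Qed.
End LaguerreInt.

(** * Exclusion of a degree by one prime *)

Section Exclusion.
Local Open Scope nat_scope.

Definition has_factor n al k :=
  exists G H : {poly int}, (G * H)%R = lagint n al /\ size G = k.+1.

Lemma has_factor_sizes n al k (G H : {poly int}) :
  (G * H)%R = lagint n al -> size G = k.+1 ->
  [/\ k <= n, size H = (n - k).+1 & `|lead_coef G| = 1].
Proof.
move=> GH sG; have L0 : lagint n al != 0%R by rewrite -size_poly_eq0 size_lagint.
have [G0 H0] : G != 0%R /\ H != 0%R by move: L0; rewrite -GH mulf_eq0 negb_or => /andP.
have := size_lagint n al; rewrite -GH size_mul // sG addSn /= => e.
have sH : 0 < size H by rewrite size_poly_gt0.
have kn : k <= n by rewrite -ltnS -e -addn1 leq_add2l.
split=> //; first by rewrite -subSn // -e addKn.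
have : `|lead_coef (lagint n al)| = 1.
  by rewrite lead_coefE size_lagint absz_lagint // lcoefn.
by rewrite -GH lead_coefM abszM => /eqP; rewrite muln_eq1 => /andP[/eqP].
Qed.

(** If p^m exceeded both bounds, n mod p^m would be i < k while k mod p^m is k, against
    [mod_prime_power]. *)
Lemma has_factor_pow n al k i p m : has_factor n al k -> prime p -> i < k ->
  p ^ m %| n - i -> p ^ m <= maxn k (al + i).
Proof.
move=> [G [H [GH sG]]] pp ik qd; have [kn _ _] := has_factor_sizes GH sG.
rewrite leqNgt gtn_max; apply/negP => /andP[kq aq].
have ni : n %% p ^ m = i.
  rewrite -(subnK (leq_trans (ltnW ik) kn)) -modnDml (eqP qd) add0n modn_small //.
  exact: ltn_trans ik kq.
have := @mod_prime_power p pp n al G H k m GH sG; rewrite ni => /(_ aq).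
by rewrite (modn_small kq) leqNgt ik.
Qed.

Lemma logn_fact_leq p n : prime p -> logn p n`! * p.-1 <= n.
Proof.
move=> pp; have p0 := prime_gt0 pp; rewrite (logn_fact_wide pp (ltnSn n)).
suff h M : (\sum_(1 <= x < M.+1) n %/ p ^ x) * p.-1 + n %/ p ^ M <= n.
  exact: leq_trans (leq_addr _ _) (h n).
elim: M => [|M IH]; first by rewrite big_geq // expn0 divn1.
rewrite big_nat_recr //= mulnDl; apply: leq_trans IH; rewrite -addnA leq_add2l.
rewrite expnSr divnMA; set d := n %/ p ^ M.
by rewrite -[X in _ + X]muln1 -mulnDr addn1 prednK // leq_trunc_div.
Qed.

Lemma ffact_dvd m s i : i < s -> m - i %| m ^_ s.
Proof. by move=> lt; rewrite ffact_prod (bigD1 (Ordinal lt)) //= dvdn_mulr. Qed.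

(** Exchanging the two falling factorials also writes the coefficient as C(n + al, n - j) times the
    falling factorial of n. *)
Lemma lcoef_dvd n al j i : j <= n -> i < n - j ->
  (n - i %| lcoef n al j) /\ (n + al - i %| lcoef n al j).
Proof.
move=> jn inj; split; last by rewrite dvdn_mull // ffact_dvd.
rewrite /lcoef -bin_sub // -[(n + al) ^_ _]bin_ffact mulnCA bin_ffact.
by rewrite dvdn_mull // ffact_dvd.
Qed.

Lemma fact_dvd m n : m <= n -> m`! %| n`!.
Proof. by move=> mn; rewrite -(ffact_fact (leq_subr m n)) subKn // dvdn_mull. Qed.

(* For larger j the inequality follows from (p - 1) v_p(m!) <= m. *)
Lemma small_slope_lagint n al k p i : has_factor n al k -> prime p -> 0 < k -> k.+1 < p ->
  i < k -> (p %| n - i) || (p %| n + al - i) ->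
  (forall j, 0 < j <= n -> j * (p.-1 - k) <= k * al ->
    k * (logn p (j + al)`! - logn p al`!) < j + k * logn p 'C(n, j)) -> False.
Proof.
move=> [G [H [GH sG]]] pp k0 kp ik pdvd chk.
have [kn sH leadG] := has_factor_sizes GH sG.
have p0 := prime_gt0 pp.
apply: (small_slope pp sG sH) => //; rewrite ?GH ?k0 ?kn ?lagint_neq0 //.
- by rewrite absz_lagint // lcoefn logn1.
- move=> j jnk; have jn : j <= n by apply: leq_trans jnk (leq_subr _ _).
  have inj : i < n - j by move: jnk ik kn; clear; lia.
  have [d1 d2] := lcoef_dvd al jn inj.
  rewrite absz_lagint //.
  by case/orP: pdvd => h; [apply: dvdn_trans h d1 | apply: dvdn_trans h d2].
move=> j j0 Lj; have jn := lagint_le Lj.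
(* With [ej] and [eC] this gives v(c_0) - v(c_j) = v((j + al)!) - v(al!) - v(C(n, j)), where c_j is
   the coefficient of index j. *)
have e0 := logn_lcoef p al (leq0n n).
rewrite !absz_lagint //; have ej := logn_lcoef p al jn.
have eC : logn p 'C(n, j) + (logn p j`! + logn p (n - j)`!) = logn p n`!.
  by rewrite -(bin_fact jn) !lognM ?muln_gt0 ?fact_gt0 ?bin_gt0.
rewrite add0n subn0 fact0 logn1 addn0 in e0.
have mono : logn p al`! <= logn p (j + al)`!.
  by rewrite dvdn_leq_log ?fact_gt0 // fact_dvd // leq_addl.
have {}chk : k * (logn p (j + al)`! - logn p al`!) < j + k * logn p 'C(n, j).
  have [h|h] := leqP (j * (p.-1 - k)) (k * al); first by apply: chk => //; rewrite j0.
  apply: leq_trans (leq_addr _ _); rewrite -(ltn_pmul2r (_ : 0 < p.-1)); last by move: kp; clear; lia.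
  apply: (@leq_ltn_trans (k * (j + al))).
    rewrite -mulnA leq_mul2l; apply/orP; right; apply: leq_trans (logn_fact_leq _ pp).
    by rewrite leq_mul2r leq_subr orbT.
  move: h (kp); rewrite mulnBr mulnDr [k * j]mulnC; have : j * k <= j * p.-1.
    by rewrite leq_mul2l -ltnS prednK // (ltnW kp) orbT.
  clear; lia.
move: chk e0 ej eC mono; move: (logn p (lcoef n al j)) (logn p (lcoef n al 0)).
move=> x y; rewrite mulnBr => chk e0 ej eC mono.
have {}e0 : k * y = k * (logn p (n + al)`! - logn p al`!) by congr (_ * _); move: e0; clear; lia.
have {}ej : k * x = k * (logn p 'C(n, j) + logn p (n + al)`! - logn p (j + al)`!).
  by congr (_ * _); move: ej eC; clear; lia.
have mono2 : logn p (j + al)`! <= logn p (n + al)`!.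
  by rewrite dvdn_leq_log ?fact_gt0 // fact_dvd // leq_add2r.
have m1 : k * logn p (j + al)`! <= k * logn p (n + al)`! by rewrite leq_mul2l mono2 orbT.
have m2 : k * logn p al`! <= k * logn p (j + al)`! by rewrite leq_mul2l mono orbT.
rewrite e0 ej !mulnBr mulnDr; move: chk m1 m2; clear; lia.
Qed.

(** For al > 0 the remaining indices satisfy j <= k, hence j + al < p and the factorial is prime to
    p; for al = 0 none remain. *)
Lemma large_prime_lagint n al k p i : has_factor n al k -> prime p -> 0 < k -> k.+1 < p ->
  al + k < p -> i < k -> (p %| n - i) || (p %| n + al - i) -> False.
Proof.
move=> hf pp k0 kp akp ik pd; apply: (small_slope_lagint hf pp k0 kp ik pd) => j /andP[j0 _] h.
have jk : al <= 0 \/ j <= k.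
  case: (posnP al) => [->|a0]; [by left | right].
  have : j * al <= k * al by apply: leq_trans h; rewrite leq_mul2l; apply/orP; right; move: akp; clear; lia.
  by rewrite leq_pmul2r.
case: jk => [|jk].
  rewrite leqn0 => /eqP al0; move: h; rewrite al0 muln0 leqn0 muln_eq0.
  rewrite -leqn0 leqNgt j0 subn_eq0 /= => h1; exfalso.
  by move: kp h1; clear; lia.
have -> : logn p (j + al)`! = 0.
  rewrite logn_fact // big_nat_cond big1 // => x /andP[/andP[x0 _] _].
  apply: divn_small; apply: (@leq_trans p); last by rewrite -{1}(expn1 p) leq_exp2l ?prime_gt1.
  by rewrite addnC; apply: leq_ltn_trans akp; rewrite leq_add2l.
by rewrite sub0n muln0 ltn_addr.
Qed.
End Exclusion.

(* Conditionals rather than && and ||, so that call-by-value evaluation stops early. *)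
Notation "a 'andif' b" := (if a then b else false) (at level 40, left associativity).
Notation "a 'orif' b" := (if a then true else b) (at level 50, left associativity).

(** * Transfer of computations on binary numbers to [nat] *)

Section BinaryComputation.
Local Open Scope nat_scope.
Local Notation nn := N.to_nat.

Lemma nnD a b : nn (a + b)%num = nn a + nn b. Proof. exact: N2Nat.inj_add. Qed.
Lemma nnM a b : nn (a * b)%num = nn a * nn b. Proof. exact: N2Nat.inj_mul. Qed.
Lemma nnB a b : nn (a - b)%num = nn a - nn b. Proof. exact: N2Nat.inj_sub. Qed.
Lemma nn_lt a b : (a <? b)%num = (nn a < nn b). Proof. lia. Qed.
Lemma nn_le a b : (a <=? b)%num = (nn a <= nn b). Proof. lia. Qed.

Lemma nn_divmod a b : b <> 0%num ->
  nn (N.div a b) = nn a %/ nn b /\ nn (N.modulo a b) = nn a %% nn b.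
Proof.
move=> b0; have e := N.div_mod a b b0; have l := N.mod_lt a b b0.
have {e} : nn a = nn (N.div a b) * nn b + nn (N.modulo a b).
  by rewrite {1}e nnD nnM mulnC.
have {l} : nn (N.modulo a b) < nn b by lia.
move=> l ->; rewrite divnMDl; last by apply: leq_ltn_trans l.
by rewrite divn_small // modnMDl modn_small // addn0.
Qed.

Fixpoint all_from (len : nat) (x : N) (P : N -> bool) :=
  if len is l.+1 then P x andif all_from l (N.succ x) P else true.

Fixpoint ex_in (T : Type) (P : T -> bool) (s : seq T) :=
  if s is x :: s' then P x orif ex_in P s' else false.

Lemma ex_inE T (P : T -> bool) s : ex_in P s = has P s.
Proof. by elim: s => //= x s ->; case: (P x). Qed.

Lemma all_fromP len lo P x : all_from len lo P -> nn lo <= x < nn lo + len ->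
  P (N.of_nat x).
Proof.
elim: len lo => [|len IH] lo /=; first by rewrite addn0 => _; case: ltngtP.
rewrite -/(_ && _) => /andP[P0 /IH h] /andP[]; rewrite leq_eqVlt => /orP[/eqP <- _|h1 h2].
  by rewrite N2Nat.id.
by apply: h; lia.
Qed.
End BinaryComputation.

(** * Degrees at least 10 *)

Section LargeDegree.
Local Open Scope nat_scope.
Local Notation nn := N.to_nat.

(** Stated with 50 in place of al, so that one prime serves all al at once. *)
Lemma factor_prime_mod n al k q : has_factor n al k -> prime q -> al <= 50 ->
  50 + n %% q < q -> n %% q < k -> k < q -> False.
Proof.
move=> [G [H [GH sG]]] pq al50 h1 h2 h3.
have h4 : al + n %% q < q by apply: leq_ltn_trans h1; rewrite leq_add2r.
have := @mod_prime_power q pq n al G H k 1 GH sG; rewrite expn1 => /(_ h4).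
by rewrite (modn_small h3) leqNgt h2.
Qed.

Definition multiple_primes : seq N :=
  [:: 59; 61; 67; 71; 73; 79; 83; 89; 97; 101; 103; 107; 109; 113; 131; 137; 139; 149; 157; 163;
    173; 179; 191; 211; 227; 229; 233; 241; 251; 257; 271; 307; 331; 353; 373; 383; 431; 743;
    991]%num.
Definition gap_primes : seq N :=
  [:: 101; 151; 199; 241; 283; 331; 379; 421; 467; 509; 557; 607; 653; 701; 751; 797; 839; 887;
    937; 983; 1033; 1069; 1117; 1163; 1213; 1259; 1307; 1327; 1373; 1423; 1471; 1511; 1559; 1609;
    1657; 1699; 1747; 1789; 1831; 1879; 1913; 1951]%num.
Definition small_primes : seq N :=
  [:: 109; 107; 103; 101; 97; 89; 83; 79; 73; 71; 67; 61; 59; 53; 47; 43; 41; 37; 31; 29; 23; 19;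
    17; 13; 11; 7; 5; 3; 2]%num.

Lemma primes_prime : all (fun p => prime (nn p)) (multiple_primes ++ gap_primes ++ small_primes).
Proof. by vm_compute. Qed.

Lemma mem_prime p : p \in multiple_primes ++ gap_primes ++ small_primes -> prime (nn p).
Proof. exact: (allP primes_prime). Qed.

(* Each 59 <= n < 2000 exceeds a multiple of some prime > 50 by at most 9, and (if n >= 102) some
   prime by at most 50. *)
Definition near_multiple_test n := ex_in (fun p => (n mod p <? 10) andif (50 + n mod p <? p))%num multiple_primes.
Definition near_prime_test n :=
  ex_in (fun p => (n <? 2 * p) andif (n mod p <? 51) andif (50 + n mod p <? p))%num gap_primes.

Lemma near_multiple_all : all_from 1941 59 near_multiple_test. Proof. by vm_compute. Qed.
Lemma near_prime_all : all_from 1898 102 near_prime_test. Proof. by vm_compute. Qed.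

(** For k <= 50 the remainder of n modulo the prime found is at most 9 < k, and k is below the prime
    since the latter exceeds 50. For k > 50 the remainder is at most 50 < k, and n < 2p gives k <
    p. *)
Lemma medium_n n al k : has_factor n al k -> al <= 50 -> 9 < k -> k.*2 <= n ->
  59 <= n < 2000 -> False.
Proof.
move=> hf al50 k9 kn /andP[n59 n2000].
have [k50|k50] := leqP k 50.
  have := all_fromP near_multiple_all (x := n); rewrite n59 n2000 => /(_ isT); rewrite /near_multiple_test ex_inE => /hasP[p pin].
  have pp : prime (nn p) by apply: mem_prime; rewrite mem_cat pin.
  have p0 : p <> 0%num by move=> p0; rewrite p0 in pp.
  rewrite !nn_lt nnD !(nn_divmod _ p0).2 Nat2N.id -/(_ && _) => /andP[h1 h2].
  apply: (factor_prime_mod hf pp al50 h2); first exact: leq_trans h1 k9.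
  by apply: leq_ltn_trans k50 _; apply: leq_ltn_trans h2; apply: leq_addr.
have n102 : 102 <= n by move: k50 kn; rewrite -addnn; clear; lia.
have := all_fromP near_prime_all (x := n); rewrite n102 n2000 => /(_ isT); rewrite /near_prime_test ex_inE => /hasP[p pin].
have pp : prime (nn p) by apply: mem_prime; rewrite !mem_cat pin orbT.
have p0 : p <> 0%num by move=> p0; rewrite p0 in pp.
rewrite !nn_lt nnD nnM !(nn_divmod _ p0).2 Nat2N.id -!/(_ && _) => /andP[/andP[h3 h1] h2].
apply: (factor_prime_mod hf pp al50 h2); first exact: leq_trans h1 k50.
by rewrite -ltn_double; apply: leq_ltn_trans kn _; rewrite -mul2n.
Qed.

(** A remainder r < k of n or n + al exhibits the i = r for which p divides n - i or n + al - i in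
    [large_prime_lagint]. *)
Definition large_prime_test n k al :=
  ex_in (fun p => (al + k <? p) andif (k + 1 <? p) andif ((n mod p <? k) orif ((n + al) mod p <? k)))%num small_primes.

Lemma large_prime_all : all_from 39 20 (fun n => all_from 20 10 (fun k =>
  (n <? 2 * k)%num orif all_from 51 0 (large_prime_test n k))).
Proof. by vm_compute. Qed.

Lemma small_n n al k : has_factor n al k -> al <= 50 -> 9 < k -> k.*2 <= n < 59 -> False.
Proof.
move=> hf al50 k9 /andP[kn n59]; move: kn; rewrite -mul2n => kn.
have := all_fromP large_prime_all (x := n); rewrite n59 (_ : nn 20 <= n); last by move: k9 kn; clear; lia.
move=> /(_ isT) h; have := all_fromP h (x := k); rewrite k9 (_ : k < _ + 20); last by move: n59 kn; clear; lia.
rewrite -/(_ || _) => /(_ isT) /orP[|h2]; first by rewrite nn_lt nnM !Nat2N.id ltnNge kn.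
have := all_fromP h2 (x := al); rewrite leq0n ltnS al50 => /(_ isT); rewrite /large_prime_test ex_inE => /hasP[p pin].
have pp : prime (nn p) by apply: mem_prime; rewrite !mem_cat pin !orbT.
have p0 : p <> 0%num by move=> p0; rewrite p0 in pp.
rewrite !nn_lt !nnD !(nn_divmod _ p0).2 nnD !Nat2N.id -/(_ || _) -!/(_ && _) => /andP[/andP[h3]]; rewrite addn1 => h4.
have k0 : 0 < k by apply: leq_trans k9.
have key m : m %% nn p < k -> nn p %| m - m %% nn p by move=> _; rewrite {1}(divn_eq m (nn p)) addnK dvdn_mull.
by case/orP=> h5; apply: (large_prime_lagint hf pp k0 h4 h3 h5); rewrite (key _ h5) ?orbT.
Qed.
End LargeDegree.

(** * Size of binomial coefficients for n >= 2000 *)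

Section LargeIndex.
Local Open Scope nat_scope.
Local Notation nn := N.to_nat.

(** Kummer's theorem: the valuation c counts the positions x >= 1 with a borrow, and c such
    positions cannot all lie below c. *)
Lemma logn_bin_carry p n k : prime p -> k <= n -> 0 < logn p 'C(n, k) ->
  exists2 m, logn p 'C(n, k) <= m & n %% p ^ m < k %% p ^ m.
Proof.
move=> pp kn; set c := logn p _ => c0.
pose carry x := n %% p ^ x < k %% p ^ x.
have cE : c = \sum_(1 <= x < n.+1) carry x.
  have : c + (logn p k`! + logn p (n - k)`!) = logn p n`!.
    by rewrite -(bin_fact kn) !lognM ?muln_gt0 ?fact_gt0 ?bin_gt0.
  rewrite !(logn_fact_wide (M := n.+1) pp) ?ltnS ?leq_subr // -big_split /=.
  have -> : \sum_(1 <= x < n.+1) n %/ p ^ x =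
     \sum_(1 <= x < n.+1) carry x + \sum_(1 <= x < n.+1) (k %/ p ^ x + (n - k) %/ p ^ x).
    rewrite -big_split /=; apply: eq_bigr => x _.
    have P0 : 0 < p ^ x by rewrite expn_gt0 prime_gt0.
    rewrite (divnB k n P0) -/(carry x).
    have h1 := leq_div2r (p ^ x) kn.
    suff : k %/ p ^ x + carry x <= n %/ p ^ x by move: h1; clear; lia.
    rewrite /carry; case: ltnP => /= h; rewrite ?addn0 // addn1 ltn_neqAle h1 andbT.
    apply/eqP => e; move: kn; rewrite (divn_eq k (p ^ x)) (divn_eq n (p ^ x)) e.
    by rewrite leq_add2l leqNgt h.
  by move/addIn.
(* otherwise only the c - 1 positions below c could carry *)
case: (boolP [exists m : 'I_n.+1, (c <= m) && carry m]) => [/existsP[m /andP[cm hm]]|none].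
  by exists m.
suff : c <= c.-1 by move: c0; clear; lia.
rewrite {1}cE; apply: (@leq_trans (\sum_(1 <= x < n.+1) (x < c))).
  rewrite big_nat_cond [X in _ <= X]big_nat_cond; apply: leq_sum => x /andP[/andP[_ xn] _].
  have := none; rewrite negb_exists => /forallP /(_ (Ordinal xn)) /=.
  by rewrite negb_and -ltnNge; case: (x < c) => //=; case: (carry x).
elim: {cE none} n.+1 => [|N IH]; first by rewrite big_geq.
case: N IH => [|N] IH; first by rewrite big_geq.
rewrite big_nat_recr //=; case: (ltnP N.+1 c) => [h|_]; last by rewrite addn0.
rewrite (eq_big_nat _ _ (F2 := fun=> 1)) => [|x /andP[_ xN]]; last by rewrite (ltn_trans xN h).
by rewrite sum_nat_const_nat muln1 /=; move: h; clear; lia.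
Qed.

Lemma dvd_pow_le d M X : 0 < d -> (forall p, prime p -> p ^ logn p d <= M) ->
  (forall i, 0 < i <= M -> i %| X) -> d %| X.
Proof.
move=> d0 hd hX; apply/(dvdn_partP _ d0) => p; rewrite mem_primes => /andP[pp _].
by rewrite p_part; apply: hX; rewrite expn_gt0 prime_gt0 // hd.
Qed.

(** At a borrow p^m, [mod_prime_power] can only fail through its hypothesis, so p^m <= al + n mod
    p^m < al + k. *)
Lemma factor_bin_pow n al k p : has_factor n al k -> prime p -> 0 < k ->
  p ^ logn p 'C(n, k) <= maxn 1 (al + k.-1).
Proof.
move=> [G [H [GH sG]]] pp k0; have [kn _ _] := has_factor_sizes GH sG.
case: (posnP (logn p 'C(n, k))) => [->|c0]; first by rewrite expn0 leq_maxl.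
have [m cm hm] := logn_bin_carry pp kn c0.
have P0 : 0 < p ^ m by rewrite expn_gt0 prime_gt0.
apply: (@leq_trans (p ^ m)); first by rewrite leq_exp2l ?prime_gt1.
have := @mod_prime_power p pp n al G H k m GH sG; case: ltnP => [_ /(_ isT)|h _].
  by rewrite leqNgt hm.
apply: leq_trans (leq_maxr _ _); apply: leq_trans h _; rewrite leq_add2l -ltnS prednK //.
by apply: leq_trans hm _; apply: leq_mod.
Qed.

(** The same failure, p^m <= al + n mod p^m, puts a multiple of p^m among n + 1, ..., n + al. *)
Lemma factor_bin_dvd n al k : has_factor n al k -> 'C(n, k) %| (n + al) ^_ al.
Proof.
move=> [G [H [GH sG]]]; have [kn _ _] := has_factor_sizes GH sG.
apply/dvdn_partP; first by rewrite bin_gt0.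
move=> p; rewrite mem_primes => /andP[pp _]; rewrite p_part.
case: (posnP (logn p 'C(n, k))) => [->|c0]; first by rewrite expn0 dvd1n.
have [m cm hm] := logn_bin_carry pp kn c0.
have P0 : 0 < p ^ m by rewrite expn_gt0 prime_gt0.
apply: dvdn_trans (dvdn_exp2l p cm) _.
have := @mod_prime_power p pp n al G H k m GH sG; case: ltnP => [_ /(_ isT)|h _].
  by rewrite leqNgt hm.
have r := ltn_pmod n P0.
(* This i makes n + al - i the first multiple of p^m above n. *)
apply: dvdn_trans (ffact_dvd _ (i := al - (p ^ m - n %% p ^ m)) _); last by move: h r; clear; lia.
have -> : n + al - (al - (p ^ m - n %% p ^ m)) = n %/ p ^ m * p ^ m + p ^ m.
  by move: h r (divn_eq n (p ^ m)); clear; lia.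
by rewrite dvdn_add // dvdn_mull.
Qed.

Fixpoint ffN (n : N) k : N := if k is k'.+1 then (n * ffN (N.pred n) k')%num else 1%num.

Lemma nn_ffN n k : nn (ffN n k) = nn n ^_ k.
Proof.
elim: k n => [|k IH] n //=; rewrite nnM IH ffactnS; congr (_ * _ ^_ _); lia.
Qed.

Definition dvd_upto M X := all_from M 1 (fun i => (X mod i =? 0)%num).
Lemma dvd_uptoP M X i : dvd_upto M X -> 0 < i <= M -> i %| nn X.
Proof.
move=> h /andP[i0 iM]; have := all_fromP h (x := i); rewrite i0 add1n ltnS iM => /(_ isT).
have i0' : N.of_nat i <> 0%num by move: i0; clear; lia.
have := (nn_divmod X i0').2; rewrite Nat2N.id /dvdn => <-.
by move/N.eqb_eq => ->.
Qed.

(* X is meant to be lcm(1, ..., k + 49) *)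
Definition below_bin k X := (0 <? X)%num andif dvd_upto (k + 49) X
  andif (X * ffN (N.of_nat k) k <? ffN 2000 k)%num.

Fixpoint below_bin_from len k X := if len is l.+1 then
  below_bin k X andif below_bin_from l k.+1 (N.lcm X (N.of_nat (k + 50))) else true.

Lemma below_bin_fromP len k X j : below_bin_from len k X -> k <= j < k + len ->
  exists Y, below_bin j Y.
Proof.
elim: len k X => [|len IH] k X /=; first by rewrite addn0; case: ltngtP.
rewrite -/(_ && _) => /andP[h0 /IH h] /andP[]; rewrite leq_eqVlt => /orP[/eqP <- _|h1 h2].
  by exists X.
by apply: h; rewrite h1 addSnnS.
Qed.

Lemma below_bin_all :
  below_bin_from 90 10 (foldr (fun i X => N.lcm (N.of_nat i) X) 1%num (iota 1 59)).
Proof. by vm_compute. Qed.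

Lemma bin_monor n j k : j <= k -> k.*2 <= n -> 'C(n, j) <= 'C(n, k).
Proof.
elim: k => [|k IH]; first by rewrite leqn0 => /eqP ->.
rewrite leq_eqVlt ltnS => /orP[/eqP -> //|jk] kn.
apply: leq_trans (IH jk _) _; first by move: kn; clear; lia.
rewrite -(leq_pmul2l (ltn0Sn k)) mul_bin_left leq_mul2r; apply/orP; right.
by move: kn; clear; lia.
Qed.

Lemma ffact2050_lt : (ffN 2050 50 * ffN 100 100 <? ffN 2000 100)%num.
Proof. by vm_compute. Qed.

(** From n to n + 1 the left side grows by (n + 51)/(n + 1) and the right side by (n + 1)/(n - 99),
    which is larger. *)
Lemma bin100_gt n : 2000 <= n -> (n + 50) ^_ 50 < 'C(n, 100).
Proof.
elim: n => // n IH; rewrite leq_eqVlt => /orP[/eqP <-|].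
  have e1 : nn 2050 = 2000 + 50 by [].
  have e2 : nn 2000 = 2000 by [].
  have e3 : nn 100 = 100 by [].
  have h := ffact2050_lt; rewrite nn_lt nnM !nn_ffN e1 e2 e3 -(bin_ffact 2000 100) ffactnn in h.
  by rewrite (ltn_pmul2r (fact_gt0 100)) in h.
rewrite ltnS => n2000; have {}IH := IH n2000.
have e1 : n.+1 * 'C(n, 100) = (n.+1 - 100) * 'C(n.+1, 100) := mul_bin_down n.+1 100.
have e2 : n.+1 * (n.+1 + 50) ^_ 50 = (n.+1 + 50) * (n + 50) ^_ 50.
  have := ffactnSr (n.+1 + 50) 50; rewrite addnK mulnC => <-.
  exact: (ffactSS (n + 50) 50).
have d0 : 0 < n.+1 * (n.+1 - 100) by rewrite muln_gt0 subn_gt0; move: n2000; clear; lia.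
rewrite -(ltn_pmul2l d0) -[ltnRHS]mulnA -e1 mulnAC e2.
apply: (@leq_ltn_trans (n.+1 * n.+1 * (n + 50) ^_ 50)).
  rewrite mulnAC leq_mul2r; apply/orP; right.
  rewrite (_ : n.+1 = n.+1 - 100 + 100); last by move: n2000; clear; lia.
  by move: (n.+1 - 100); clear; nia.
by rewrite -mulnA !ltn_pmul2l.
Qed.

(** For k < 100, C(n, k) divides lcm(1, ..., k + 49) < C(2000, k). For k >= 100 it divides (n + 1)
    ... (n + al), which is less than C(n, 100). *)
Lemma large_n n al k : has_factor n al k -> al <= 50 -> 9 < k -> k.*2 <= n -> 2000 <= n -> False.
Proof.
move=> hf al50 k9 kn n2000; have k0 : 0 < k by apply: leq_trans k9.
have Cn0 : 0 < 'C(n, k) by rewrite bin_gt0; move: kn; clear; lia.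
have [k100|k100] := ltnP k 100.
  have := below_bin_fromP (j := k) below_bin_all; rewrite k9 k100 => /(_ isT) [X].
  rewrite /below_bin -!/(_ && _) => /andP[/andP[X0 hX]].
  rewrite !nn_lt nnM !nn_ffN Nat2N.id in X0 *; rewrite ffactnn -bin_ffact.
  rewrite ltn_pmul2r ?fact_gt0 // => hlt.
  have : 'C(n, k) %| nn X.
    apply: (dvd_pow_le (M := k + 49)) => // [p pp|i]; last exact: dvd_uptoP.
    apply: leq_trans (factor_bin_pow hf pp k0) _; rewrite geq_max.
    by move: al50 k0; clear; lia.
  move/(dvdn_leq X0) => h; have := leq_trans (leq_ltn_trans h hlt) (leq_bin2l k n2000).
  by rewrite ltnn.
have h1 := leq_trans (bin100_gt n2000) (bin_monor k100 kn).
have := dvdn_leq _ (factor_bin_dvd hf); rewrite ffact_gt0 leq_addl => /(_ isT) h2.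
have h3 : (n + al) ^_ al <= (n + 50) ^_ 50.
  rewrite -(leq_pmul2r (fact_gt0 n)).
  have := ffact_fact (leq_addl n al); have := ffact_fact (leq_addl n 50).
  rewrite !addnK => -> ->; apply: dvdn_leq; rewrite ?fact_gt0 // fact_dvd //.
  by rewrite leq_add2l.
by have := leq_ltn_trans (leq_trans h2 h3) h1; rewrite ltnn.
Qed.

Theorem no_large_factor n al k : has_factor n al k -> al <= 50 -> 9 < k -> k.*2 <= n -> False.
Proof.
move=> hf al50 k9 kn; have [n59|n59] := ltnP n 59.
  by apply: (small_n hf) => //; rewrite kn.
have [n2|n2] := ltnP n 2000; last exact: (large_n hf).
by apply: (medium_n hf) => //; rewrite n59.
Qed.
End LargeIndex.

(** * Degrees 2 to 9 *)

Section SmallDegree.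
Local Open Scope nat_scope.
Local Notation nn := N.to_nat.

Lemma logn_fact_step p m : prime p -> logn p m`! = m %/ p + logn p (m %/ p)`!.
Proof.
move=> pp; rewrite (logn_fact_wide (M := m.+2) pp) // big_ltn // expn1; congr (_ + _).
rewrite (logn_fact_wide (M := m.+1) pp) ?ltnS ?leq_div // big_add1 /=.
by apply: eq_bigr => x _; rewrite expnS divnMA.
Qed.

Lemma nnX a b : nn (a ^ b)%num = nn a ^ nn b.
Proof.
rewrite -{1}(N2Nat.id b); elim: (nn b) => [|k IH] //.
by rewrite Nat2N.inj_succ N.pow_succ_r' nnM IH expnS.
Qed.

Fixpoint vfact_fuel (fuel : nat) (p m : N) : N := if fuel is f.+1 then
  let q := (m / p)%num in if (q =? 0)%num then 0%num else (q + vfact_fuel f p q)%num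
  else 0%num.

(** Each division by p at least halves the argument, so fuel 14 suffices below 2^14 = 16384. *)
Definition vfact := vfact_fuel 14.

Lemma vfactE p m : prime (nn p) -> (m <? 16384)%num ->
  nn (vfact p m) = logn (nn p) (nn m)`!.
Proof.
move=> pp; rewrite nn_lt (_ : nn 16384 = 2 ^ 14); last exact: (nnX 2 14).
rewrite /vfact; elim: 14 m => [|f IH] m /=.
  by rewrite expn0 ltnS leqn0 => /eqP ->; rewrite fact0 logn1.
have p0 : p <> 0%num by move=> p0; rewrite p0 in pp.
move=> mf; have [dE _] := nn_divmod m p0; rewrite logn_fact_step // -dE.
case: (N.eqb_spec (m / p) 0) => [->|_]; first by rewrite fact0 logn1.
rewrite nnD IH // dE ltn_divLR ?prime_gt0 //.
apply: leq_trans mf _; rewrite expnSr leq_mul2l; apply/orP; right; exact: prime_gt1.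
Qed.

Lemma nn_prime_neq0 p : prime (nn p) -> p <> 0%num.
Proof. by move=> pp p0; rewrite p0 in pp. Qed.

(** The quotient bounding j is the range left to check by [small_slope_lagint]. *)
Definition slope_test p n k al := let va := vfact p al in let vn := vfact p n in
  (0 <? k)%num andif (k + 1 <? p)%num
  andif ((n mod p <? k)%num orif ((n + al) mod p <? k)%num)
  andif (n + al <? 16384)%num
  andif all_from (nn (N.min n (k * al / (p - 1 - k)))) 1 (fun j =>
    k * (vfact p (j + al) - va) <? j + k * (vn - vfact p j - vfact p (n - j)))%num.

Lemma slope_testP p n k al : prime (nn p) -> slope_test p n k al ->
  has_factor (nn n) (nn al) (nn k) -> False.
Proof.
move=> pp; have p0 := nn_prime_neq0 pp; rewrite /slope_test -!/(_ && _) -/(_ || _).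
move=> /andP[/andP[/andP[/andP[k0 kp] hdvd] bound] hall] hf.
rewrite !nn_lt !(nn_divmod _ p0).2 ?nnD in k0 kp hdvd.
have kp' : (nn k).+1 < nn p by move: kp; clear; lia.
have [i ik pd] : exists2 i, i < nn k & (nn p %| nn n - i) || (nn p %| nn n + nn al - i).
  have key m : nn p %| m - m %% nn p by rewrite {1}(divn_eq m (nn p)) addnK dvdn_mull.
  by case/orP: hdvd => h; [exists (nn n %% nn p) | exists ((nn n + nn al) %% nn p)];
    rewrite ?key ?orbT.
apply: (small_slope_lagint hf pp k0 kp' ik pd) => j /andP[j0 jn] jal.
have d0 : (p - 1 - k)%num <> 0%num by move: kp'; clear; lia.
have jX : j <= nn (k * al / (p - 1 - k)).
  by rewrite (nn_divmod _ d0).1 nnM leq_divRL ?nnB ?subn1 //; move: kp'; clear; lia.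
have jmin : j <= nn (N.min n (k * al / (p - 1 - k))).
  by move: (k * al / (p - 1 - k))%num jX jn => X; clear; lia.
have := all_fromP hall (x := j); rewrite j0 add1n ltnS jmin => /(_ isT).
 rewrite nn_lt nnM (nnD (N.of_nat j)) nnM !nnB Nat2N.id !vfactE //;
  try by move: jn bound; clear; lia.
rewrite !(nnD, nnB) !Nat2N.id.
suff -> : logn (nn p) 'C(nn n, j) = logn (nn p) (nn n)`! - logn (nn p) j`! - logn (nn p) (nn n - j)`! by [].
by rewrite -(bin_fact jn) !lognM ?muln_gt0 ?fact_gt0 ?bin_gt0 // -subnDA addnK.
Qed.

(** A test uniform in all n divisible by p^m: v(C(n, j)) is replaced by its lower bound m - v(j),
    with v(j) obtained as v(j!) - v((j - 1)!). *)
Definition slope_test_dvd p k m al := let va := vfact p al in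
  (k + 1 <? p)%num andif (k * al / (p - 1 - k) + al <? 16384)%num
  andif all_from (nn (k * al / (p - 1 - k))) 1 (fun j =>
    k * (vfact p (j + al) - va - (m - (vfact p j - vfact p (j - 1)))) <? j)%num.

(** This comes from j C(n, j) = n C(n - 1, j - 1). *)
Lemma logn_bin_ge p n j m : 0 < j <= n -> p ^ m %| n -> prime p ->
  m <= logn p j + logn p 'C(n, j).
Proof.
case: j => // j jn qn pp; have n0 : 0 < n by apply: leq_ltn_trans jn.
rewrite -lognM ?bin_gt0 // -mul_bin_diag lognM // ?bin_gt0; last by move: jn n0; clear; lia.
by rewrite (pfactor_dvdn m pp n0) in qn; apply: leq_trans qn (leq_addr _ _).
Qed.

Lemma slope_test_dvdP p k m al n k' : prime (nn p) -> slope_test_dvd p k m al ->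
  0 < k' <= nn k -> 0 < nn m -> nn p ^ nn m %| n -> has_factor n (nn al) k' -> False.
Proof.
move=> pp; have p0 := nn_prime_neq0 pp; rewrite /slope_test_dvd -!/(_ && _).
move=> /andP[/andP[kp bound] hall] /andP[k0 kk] m0 qn hf.
rewrite nn_lt nnD in kp.
have kp' : (nn k).+1 < nn p by move: kp; clear; lia.
have pn : nn p %| n by apply: dvdn_trans qn; rewrite dvdn_exp.
have k'p : k'.+1 < nn p by apply: leq_ltn_trans kp'.
apply: (small_slope_lagint hf pp k0 k'p k0); first by rewrite subn0 pn.
move=> j /andP[j0 jn] jal.
have d0 : (p - 1 - k)%num <> 0%num by move: kp'; clear; lia.
(* A smaller degree k' has a smaller range of j, so the test for k covers it. *)
have jal' : j * (nn p - 1 - nn k) <= nn k * nn al.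
  apply: leq_trans (leq_mul kk (leqnn _)); apply: leq_trans jal.
  by rewrite leq_mul2l subn1 leq_sub2l ?orbT.
have jJ : j <= nn (k * al / (p - 1 - k)).
  by rewrite (nn_divmod _ d0).1 nnM leq_divRL ?nnB //; move: kp'; clear; lia.
have := all_fromP hall (x := j); rewrite j0 add1n ltnS jJ => /(_ isT).
rewrite nn_lt nnM !nnB Nat2N.id !vfactE //;
  try by move: (k * al / (p - 1 - k))%num jJ bound; clear; lia.
rewrite !(nnD, nnB) !Nat2N.id.
have -> : logn (nn p) j`! - logn (nn p) (j - nn 1)`! = logn (nn p) j.
  by rewrite (_ : j - nn 1 = j.-1) ?subn1 // -{1}(prednK j0) factS prednK // lognM ?fact_gt0 // addnK.
have := logn_bin_ge (_ : 0 < j <= n) qn pp; rewrite j0 jn => /(_ isT).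
set u := _ - logn _ (nn al)`!; set v := logn _ j; set w := logn _ _ => h1 h2.
have h3 : k' * (u - (nn m - v)) <= nn k * (u - (nn m - v)) by rewrite leq_mul2r kk orbT.
have h4 : k' * u <= k' * (u - (nn m - v)) + k' * w.
  by rewrite -mulnDr leq_mul2l; apply/orP; right; move: h1; clear; lia.
by apply: leq_ltn_trans h4 _; rewrite ltn_add2r; apply: leq_ltn_trans h3 h2.
Qed.

(** Each prime power exactly dividing n - i is at most the bound in [has_factor_pow], hence divides
    X. *)
Lemma factor_dvd n al k i X : has_factor n al k -> i < k ->
  (forall j, 0 < j <= maxn k (al + i) -> j %| X) -> n - i %| X.
Proof.
move=> hf ik hX; have [[G [H [GH sG]]]] := (hf, has_factor_sizes).
move=> /(_ _ _ _ _ _ GH sG)[kn _ _].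
have ni : 0 < n - i by rewrite subn_gt0; apply: leq_trans kn.
apply: (dvd_pow_le ni _ hX) => p pp; apply: (has_factor_pow hf pp ik).
by rewrite pfactor_dvdn.
Qed.

Lemma slope_test_dvd_all :
  all (fun p => all_from 51 0 (slope_test_dvd p 9 1)) [:: 11; 13; 17; 19; 23; 29; 31; 37; 41; 43; 47]%num.
Proof. by vm_compute. Qed.

(* A prime power dividing n is at most max(k, al) <= 50, and primes p >= 11 dividing n
   are excluded by the slopes. *)
Lemma smooth7 n al k : has_factor n al k -> al <= 50 -> 0 < k <= 9 -> 0 < n ->
  exists a b c d, [/\ n = 2 ^ a * 3 ^ b * 5 ^ c * 7 ^ d, a < 6, b < 4 & c < 3 /\ d < 3].
Proof.
move=> hf al50 /andP[k0 k9] n0.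
have pw p : prime p -> p ^ logn p n <= 50.
  move=> pp; have := has_factor_pow (m := logn p n) hf pp k0.
  by rewrite subn0 addn0 pfactor_dvdn // leqnn => /(_ isT) h; apply: leq_trans h _;
    rewrite geq_max al50 (leq_trans k9).
have p7 p : prime p -> 7 < p -> logn p n = 0.
  move=> pp p7; apply/eqP; rewrite -leqn0 leqNgt -(pfactor_dvdn 1 pp n0) expn1; apply/negP => pn.
  have p50 : p <= 50.
    apply: leq_trans (pw p pp); rewrite -{1}(expn1 p) leq_exp2l ?prime_gt1 //.
    by rewrite -(pfactor_dvdn 1 pp n0) expn1.
  have pin : p \in [:: 11; 13; 17; 19; 23; 29; 31; 37; 41; 43; 47].
    have : p \in [seq q <- iota 8 43 | prime q].
      by rewrite mem_filter pp mem_iota p7 ltnS p50.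
    by [].
  have pin' : N.of_nat p \in [:: 11; 13; 17; 19; 23; 29; 31; 37; 41; 43; 47]%num.
    by move: pin; rewrite !inE; do 10! [case/orP; first by move/eqP ->]; move/eqP ->.
  have := allP slope_test_dvd_all _ pin' => hall.
  have := all_fromP hall (x := al); rewrite leq0n ltnS al50 => /(_ isT) ht.
  have pp' : prime (nn (N.of_nat p)) by rewrite Nat2N.id.
  have kk : 0 < k <= nn 9 by rewrite k0.
  apply: (slope_test_dvdP pp' ht kk (isT : 0 < nn 1)); rewrite Nat2N.id; last exact: hf.
  by rewrite expn1.
exists (logn 2 n), (logn 3 n), (logn 5 n), (logn 7 n).
(* The exponent bounds come from 2^6, 3^4, 5^3 and 7^3 exceeding 50. *)
have small p e : 1 < p -> 50 < p ^ e.+1 -> p ^ logn p n <= 50 -> logn p n <= e.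
  by move=> p1 h1 h2; rewrite -ltnS -(ltn_exp2l _ _ p1); apply: leq_ltn_trans h2 h1.
split; rewrite ?ltnS; [|exact: (small 2 5 isT isT (pw 2 isT))|exact: (small 3 3 isT isT (pw 3 isT))|
  by split; [exact: (small 5 2 isT isT (pw 5 isT)) | exact: (small 7 2 isT isT (pw 7 isT))]].
apply: eqn_from_log => // [|p]; first by rewrite !muln_gt0 !expn_gt0.
case pp : (prime p); last by rewrite [LHS]lognE [RHS]lognE pp.
rewrite !lognM ?muln_gt0 ?expn_gt0 // !lognX.
rewrite (@logn_prime p 2) // (@logn_prime p 3) // (@logn_prime p 5) // (@logn_prime p 7) //.
have [h|h] := ltnP 7 p.
  have ne q : q < 8 -> (p == q) = false by move=> q8; apply/eqP; move: h q8; clear; lia.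
  by rewrite (p7 p pp h) !ne //= !muln0.
have : p \in [seq q <- iota 0 8 | prime q] by rewrite mem_filter pp mem_iota.
rewrite (_ : [seq q <- iota 0 8 | prime q] = [:: 2; 3; 5; 7]) // !inE.
by do 3! [case/orP; first by move/eqP ->; rewrite /= !muln1 !muln0 ?addn0]; move/eqP ->; rewrite /= muln1 !muln0.
Qed.

Fixpoint lcm_list (len : nat) (i X : N) : seq N :=
  if len is l.+1 then X :: lcm_list l (N.succ i) (N.lcm X (N.succ i)) else [::].

(* The entry of index M is lcm(1, ..., M). *)
Definition lcms := Eval vm_compute in lcm_list 60 0 1.

Lemma lcms_dvd : all (fun M => dvd_upto M (nth 0%num lcms M)) (iota 0 60).
Proof. by vm_compute. Qed.

Definition nondvd_test n k al := ex_in (fun i =>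
  ~~ (nth 0 lcms (nn (N.max k (al + i))) mod (n - i) =? 0))%num (map N.of_nat (iota 0 (nn k))).

(** The least common multiple for al is a multiple of that for al' <= al; this lets [degree_test]
    try al = 50 once for all values. *)
Lemma nondvd_testP n k al al' : nondvd_test n k al -> 0 < nn k < 10 -> nn al <= 50 ->
  al' <= nn al -> has_factor (nn n) al' (nn k) -> False.
Proof.
rewrite /nondvd_test ex_inE => /hasP[x /mapP[i]]; rewrite mem_iota add0n => ik -> {x}.
move=> h /andP[k0 k9] al50 al'le hf; have [[G [H [GH sG]]]] := (hf, has_factor_sizes).
move=> /(_ _ _ _ _ _ GH sG)[kn _ _].
have ni : (n - N.of_nat i)%num <> 0%num by move: ik kn; clear; lia.
set M := nn (N.max k (al + N.of_nat i)) in h.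
have M60 : M < 60 by move: ik k9 al50; rewrite /M; clear; lia.
have := allP lcms_dvd M; rewrite mem_iota M60 => /(_ isT) hM.
have Mle : maxn (nn k) (al' + i) <= M by move: al'le; rewrite /M; clear; lia.
have hd := @factor_dvd _ _ _ i (nn (nth 0%num lcms M)) hf ik.
have [_ e] := nn_divmod (nth 0%num lcms M) ni; rewrite nnB Nat2N.id in e.
case/negP: h; apply/N.eqb_eq; apply: N2Nat.inj; rewrite e; apply/eqP.
by apply: hd => j /andP[j0 jM]; apply: dvd_uptoP hM _; rewrite j0 (leq_trans jM).
Qed.

(* (n, al, k, p, a, b, l, r): over Q_p the polynomial has a side of slope a/b from l to r *)
Definition sides : seq (N * N * N * N * N * N * N * N) :=
  [:: (4, 5, 2, 3, 2, 3, 1, 4); (4, 21, 2, 3, 1, 3, 0, 3); (4, 45, 2, 2, 5, 4, 0, 4);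
      (4, 46, 2, 3, 1, 3, 0, 3); (6, 4, 2, 5, 1, 5, 1, 6); (6, 19, 2, 3, 1, 3, 0, 6);
      (8, 13, 2, 7, 1, 7, 1, 8); (8, 20, 2, 2, 7, 8, 0, 8); (8, 41, 2, 7, 2, 7, 1, 8);
      (9, 19, 2, 2, 7, 8, 1, 9); (9, 40, 2, 3, 4, 9, 0, 9); (12, 21, 2, 2, 13, 12, 0, 12);
      (12, 43, 2, 11, 1, 11, 1, 12); (16, 24, 2, 5, 1, 5, 1, 16); (16, 34, 2, 2, 15, 16, 0, 16);
      (16, 48, 2, 2, 17, 16, 0, 16); (18, 33, 2, 3, 4, 9, 0, 18); (24, 22, 2, 23, 1, 23, 1, 24);
      (27, 38, 2, 3, 13, 27, 0, 27); (6, 4, 3, 3, 1, 2, 0, 6); (6, 44, 3, 2, 5, 4, 0, 4);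
      (9, 41, 3, 3, 4, 9, 0, 9); (16, 34, 3, 2, 15, 16, 0, 16); (18, 33, 3, 2, 15, 16, 0, 16);
      (18, 33, 4, 2, 15, 16, 0, 16)]%num.

(** U is b times the valuation of the three factorials, so the weight is a constant minus U j plus a
    j, and the last clause says that l and r are minimisers. The bound on k mod b contradicts
    [single_side]. *)
Definition side_test (c : N * N * N * N * N * N * N * N) :=
  let: (n, al, k, p, a, b, l, r) := c in
  let U j := (b * (vfact p (j + al) + vfact p j + vfact p (n - j)))%num in
  [&& prime (nn p), 0 < nn a, coprime (nn a) (nn b), nn l <= nn r <= nn n,
    nn n - (nn r - nn l) < nn b, nn n - (nn r - nn l) < nn k %% nn b,
    (n + al <? 16384)%num
    & all_from (nn n).+1 0 (fun j =>
       (U j + a * l <=? U l + a * j)%num && (U j + a * r <=? U r + a * j)%num)].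

Lemma side_testP c : side_test c ->
  let: (n, al, k, p, a, b, l, r) := c in has_factor (nn n) (nn al) (nn k) -> False.
Proof.
case: c => [[[[[[[n al] k] p] a] b] l] r] /and5P[pp a0 ab lrn /and4P[h1 h2 bound hall]].
move=> [G [H [GH sG]]]; have [kn sH _] := has_factor_sizes GH sG.
have L0 : (G * H)%R != 0%R by rewrite GH -size_poly_eq0 size_lagint.
have [lr rn] := andP lrn.
have side i : nn i <= nn n -> (forall j, j <= nn n ->
    nn b * (logn (nn p) (j + nn al)`! + logn (nn p) j`! + logn (nn p) (nn n - j)`!) + nn a * nn i <=
    nn b * (logn (nn p) (nn i + nn al)`! + logn (nn p) (nn i)`! + logn (nn p) (nn n - nn i)`!) + nn a * j) ->
  npmin (nn p) (nn a) (nn b) (G * H)%R (nn i).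
  move=> iN hi; rewrite GH; split=> [|j Lj]; first exact: lagint_neq0.
  have jn := lagint_le Lj; rewrite /wt !absz_lagint //.
  have e1 := logn_lcoef (nn p) (nn al) jn; have e2 := logn_lcoef (nn p) (nn al) iN.
  move: (hi j jn) e1 e2; set u := _ + _ + _; set v := _ + _ + _ => h e1 e2.
  have := congr1 (muln (nn b)) (etrans e1 (esym e2)); rewrite !mulnDr.
  by move: h; clear; lia.
have key i j : (i <=? n)%num -> (j <=? n)%num ->
    (b * (vfact p (j + al) + vfact p j + vfact p (n - j)) + a * i <=?
     b * (vfact p (i + al) + vfact p i + vfact p (n - i)) + a * j)%num ->
    nn b * (logn (nn p) (nn j + nn al)`! + logn (nn p) (nn j)`! + logn (nn p) (nn n - nn j)`!) + nn a * nn i <=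
    nn b * (logn (nn p) (nn i + nn al)`! + logn (nn p) (nn i)`! + logn (nn p) (nn n - nn i)`!) + nn a * nn j.
  move=> iN jN; rewrite nn_le !(nnD (b * _)) !(nnM b) !nnD !(nnM a) !vfactE //;
    try by move: iN jN bound; clear; lia.
  by rewrite !nnD !nnB.
have lN : (l <=? n)%num by move: lr rn; clear; lia.
have rN : (r <=? n)%num by move: rn; clear; lia.
have jN j : j <= nn n -> (N.of_nat j <=? n)%num by clear; lia.
have hj j : j <= nn n -> _ := fun h => all_fromP hall (x := j) h.
have ml : npmin (nn p) (nn a) (nn b) (G * H)%R (nn l).
  apply: side => [|j jn]; first by rewrite -nn_le.
  have /andP[h _] := hj j jn; have := key l (N.of_nat j) lN (jN j jn) h; by rewrite Nat2N.id.
have mr : npmin (nn p) (nn a) (nn b) (G * H)%R (nn r).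
  apply: side => // j jn.
  have /andP[_ h] := hj j jn; have := key r (N.of_nat j) rN (jN j jn) h; by rewrite Nat2N.id.
by have := single_side pp L0 a0 ab sG sH kn ml mr lrn h1; rewrite leqNgt h2.
Qed.

Lemma sides_all : all side_test sides.
Proof. by vm_compute. Qed.

Definition degree_test n k := (n <? 2 * k)%num orif nondvd_test n k 50 orif
  all_from 51 0 (fun al => nondvd_test n k al orif
    ex_in (fun p => slope_test p n k al) small_primes orif
    ex_in (fun c => let: (n', al', k', _, _, _, _, _) := c in
      (n =? n')%num andif (al =? al')%num andif (k =? k')%num) sides).

Lemma degree_test_all : all_from 6 0 (fun a => all_from 4 0 (fun b => all_from 3 0 (fun c =>
  all_from 3 0 (fun d => all_from 8 2 (degree_test (2 ^ a * 3 ^ b * 5 ^ c * 7 ^ d)))))).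
Proof. by vm_compute. Qed.

Theorem no_small_factor n al k : has_factor n al k -> al <= 50 -> 1 < k <= 9 ->
  k.*2 <= n -> False.
Proof.
move=> hf al50 /andP[k1 k9] kn; have k0 := ltnW k1.
have n0 : 0 < n by move: k0 kn; clear; lia.
have [a [b [c [d [nE a6 b4 [c3 d3]]]]]] := smooth7 hf al50 (introT andP (conj k0 k9)) n0.
have := all_fromP degree_test_all (x := a) a6.
move=> h; have {h} := all_fromP h (x := b) b4.
move=> h; have {h} := all_fromP h (x := c) c3.
move=> h; have {h} := all_fromP h (x := d) d3.
move=> h; have {h} := all_fromP h (x := k); rewrite k1 ltnS k9 => /(_ isT).
set m := (_ * _)%num; have mE : n = nn m by rewrite nE !nnM !nnX !Nat2N.id.
rewrite mE in hf kn; have kE := Nat2N.id k; rewrite -kE in hf kn k0 k9; move: hf kn k0 k9 {kE k1}.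
move: (N.of_nat k) => {}k hf kn k0 k9; rewrite /degree_test -!/(_ || _) nn_lt nnM.
rewrite (_ : nn m < _ = false); last by move: kn; clear; lia.
have k10 : 0 < nn k < 10 by rewrite k0.
case/orP; first by move=> h; apply: (nondvd_testP h k10 _ al50 hf).
move=> h; have {h} := all_fromP h (x := al); rewrite ltnS al50 -!/(_ || _) => /(_ isT).
rewrite -(Nat2N.id al) in hf al50; move: (N.of_nat al) hf al50 => {}al hf al50.
case/orP; first case/orP.
- by move=> h; apply: (nondvd_testP h k10 al50 (leqnn _) hf).
- rewrite ex_inE => /hasP[p pin hp]; apply: (slope_testP _ hp hf).
  by apply: mem_prime; rewrite !mem_cat pin !orbT.
rewrite ex_inE => /hasP[[[[[[[[n' al'] k'] p] a'] b'] l] r] cin].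
rewrite -!/(_ && _) => /andP[/andP[/N.eqb_eq e1 /N.eqb_eq e2] /N.eqb_eq e3].
by have := side_testP (allP sides_all _ cin); rewrite -e1 -e2 -e3 => /(_ hf).
Qed.
End SmallDegree.

(** * Linear factors *)

Section LinearFactor.
Local Open Scope nat_scope.
Local Notation nn := N.to_nat.

(** The leading coefficient of G is 1 or -1, so its root is an integer; y is its negative, which
    removes the alternating signs. *)
Lemma linear_factor_root n al : has_factor n al 1 ->
  exists y : int, (\sum_(j < n.+1) (lcoef n al j)%:Z * y ^+ j = 0)%R.
Proof.
move=> [G [H [GH sG]]]; have [_ _ leadG] := has_factor_sizes GH sG.
have GE : G = ((G # 1)%:P * 'X + (G # 0)%:P)%R.
  apply/polyP => i; rewrite coefD coefMX !coefC; case: i => [|[|i]] /=; rewrite ?add0r ?addr0 //.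
  by rewrite nth_default // sG.
have g1 : (G # 1 * G # 1 = 1)%R.
  by move: leadG; rewrite lead_coefE sG /= ; case: (G # 1) => [[|[|m]]|[|m]].
exists (G # 0 * G # 1)%R.
have : (lagint n al).[- (G # 0 * G # 1)]%R = 0%R.
  by rewrite -GH hornerM {1}GE !hornerE mulrN mulrCA g1 mulr1 addNr mul0r.
rewrite horner_poly => h; rewrite -[RHS]h; apply: eq_bigr => j _.
by rewrite [X in (_ = X * _)%R]mulrC -mulrA -exprMn mulN1r opprK.
Qed.

Lemma lcoef_pred n al j : 0 < j <= n ->
  lcoef n al j.-1 * (n - j).+1 = lcoef n al j * (j * (j + al)).
Proof.
case: j => // j jn; have := lcoefE al jn; have := lcoefE al (ltnW jn).
rewrite (_ : n - j = (n - j.+1).+1) /=; last by move: jn; clear; lia.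
rewrite addSn !factS => <- /eqP.
set c := lcoef n al j; set d := lcoef n al j.+1; set m := n - j.+1.
move=> e; apply/eqP; rewrite -(eqn_pmul2r (_ : 0 < (j + al)`! * j`! * m`!)) ?muln_gt0 ?fact_gt0 //.
by rewrite eq_sym in e; move: e; congr (_ == _); ring.
Qed.

(** Coefficients are produced from the leading one downwards by the ratio in [lcoef_pred], the
    division being exact. *)
Fixpoint lcoef_seq (n al : N) (j : nat) (c : N) (acc : seq N) : seq N :=
  if j is i.+1 then
    lcoef_seq n al i (c * (N.of_nat j * (N.of_nat j + al)) / (n - N.of_nat i))%num (c :: acc)
  else c :: acc.

Lemma lcoef_seqE n al j c acc : j <= nn n -> nn c = lcoef (nn n) (nn al) j ->
  map nn (lcoef_seq n al j c acc) = mkseq (lcoef (nn n) (nn al)) j.+1 ++ map nn acc.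
Proof.
elim: j c acc => [|j IH] c acc jn cE; first by rewrite /= cE.
have d0 : (n - N.of_nat j)%num <> 0%num by move: jn; clear; lia.
rewrite -[lcoef_seq _ _ _ _ _]/(lcoef_seq n al j _ (c :: acc)) IH ?(ltnW jn) //.
  by rewrite [in RHS]/mkseq -[j.+2]addn1 iotaD map_cat -catA /= cE add0n.
rewrite (nn_divmod _ d0).1 !(nnM, nnD, nnB) !Nat2N.id cE -lcoef_pred ?jn //=.
by rewrite -subSn // subSS mulnK // subn_gt0.
Qed.

Lemma sum_foldr (f : nat -> nat) m (y : int) :
  (\sum_(j < m) (f j)%:Z * y ^+ j = foldr (fun c (A : int) => c%:Z + y * A) 0 (mkseq f m))%R.
Proof.
elim: m f => [|m IH] f; first by rewrite big_ord0.
rewrite big_ord_recl expr0 mulr1 /mkseq /= (iotaDl 1 0) -map_comp -/(mkseq _ m) -IH big_distrr.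
by congr (_ + _)%R; apply: eq_bigr => i _; rewrite /= /bump /= !add1n exprS mulrCA.
Qed.

Definition horner_mod l z (cs : seq N) := foldr (fun c A => (c + z * A) mod l)%num 0%num cs.

Lemma horner_modE l z cs (y : int) : l <> 0%num -> (y - (nn z)%:Z)%R \in dvdz (nn l)%:Z ->
  (foldr (fun c (A : int) => c%:Z + y * A) 0 (map nn cs) -
     (nn (horner_mod l z cs))%:Z)%R \in dvdz (nn l)%:Z.
Proof.
move=> l0 yz; elim: cs => [|c cs IH] /=; first by rewrite subrr dvdz0.
rewrite (nn_divmod _ l0).2 nnD nnM; set B := nn (horner_mod _ _ _) in IH *.
set A := foldr _ _ _ in IH *.
set Q := ((nn c + nn z * B) %/ nn l)%N; set R := ((nn c + nn z * B) %% nn l)%N.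
have e : (R%:Z = (nn c)%:Z + (nn z)%:Z * B%:Z - Q%:Z * (nn l)%:Z)%R.
  by rewrite -!PoszM -PoszD (divn_eq (nn c + nn z * B) (nn l)) PoszD addrC addKr.
have -> : ((nn c)%:Z + y * A - R%:Z =
  (y - (nn z)%:Z) * A + (nn z)%:Z * (A - B%:Z) + Q%:Z * (nn l)%:Z)%R.
  by rewrite e; ring.
apply: rpredD; [apply: rpredD|].
- exact: dvdz_mulr yz.
- exact: dvdz_mull IH.
- exact: dvdz_mull (dvdzz _).
Qed.

Lemma horner_mod_map l z cs : l <> 0%num ->
  horner_mod l z (map (fun c => c mod l)%num cs) = horner_mod l z cs.
Proof. by move=> l0; elim: cs => //= c cs ->; rewrite N.Div0.add_mod_idemp_l. Qed.

Definition rootless_test (c : N * N * N) := let: (n, al, l) := c in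
  let cs := map (fun c => c mod l)%num (lcoef_seq n al (nn n) 1 [::]) in
  (0 <? l)%num andif all_from (nn l) 0 (fun z => ~~ (horner_mod l z cs =? 0)%num).

Lemma rootless_testP c : rootless_test c ->
  let: (n, al, l) := c in has_factor (nn n) (nn al) 1 -> False.
Proof.
case: c => [[n al] l]; rewrite /rootless_test -/(_ && _) => /andP[l0 hall] /linear_factor_root[y].
rewrite sum_foldr => y0.
have l0' : l <> 0%num by move: l0; clear; lia.
have lE : map nn (lcoef_seq n al (nn n) 1 [::]) = mkseq (lcoef (nn n) (nn al)) (nn n).+1.
  by rewrite lcoef_seqE ?cats0 // lcoefn.
have lz : (nn l)%:Z != 0%R by move: l0'; clear; lia.
set z := `|modz y (nn l)%:Z|.
have zE : z%:Z = modz y (nn l)%:Z by rewrite /z gez0_abs // modz_ge0.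
have zl : z < nn l by rewrite -ltz_nat zE ltz_pmod //; move: l0'; clear; lia.
have yz : (y - (nn (N.of_nat z))%:Z)%R \in dvdz (nn l)%:Z.
  by rewrite Nat2N.id zE {1}(divz_eq y (nn l)%:Z) addrK dvdz_mull.
have := all_fromP hall (x := z) zl.
rewrite horner_mod_map //; set r := horner_mod _ _ _ => /negP; apply.
(* The Horner value is already reduced, so divisibility by l forces it to be 0. *)
have rl : nn r < nn l.
  rewrite /r; case: (lcoef_seq _ _ _ _ _) => [|c cs] /=; first by move: l0'; clear; lia.
  by rewrite (nn_divmod _ l0').2 ltn_pmod //; move: l0'; clear; lia.
have := horner_modE (lcoef_seq n al (nn n) 1 [::]) l0' yz; rewrite -/r lE y0 sub0r rpredN.
rewrite /= dvdzE !absz_nat => /dvdnP[q qE]; apply/N.eqb_eq.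
by move: rl qE; case: q => [|q]; rewrite ?mulSn; clear; lia.
Qed.

(* (n, al, l): the polynomial has no root modulo l *)
Definition rootless : seq (N * N * N) :=
  [:: (4, 4, 31); (2, 6, 3); (4, 8, 17); (8, 8, 23); (24, 8, 41); (4, 12, 17); (4, 14, 7);
      (2, 16, 5); (8, 16, 31); (16, 16, 47); (4, 20, 13); (8, 20, 17); (16, 20, 53);
      (8, 24, 11); (16, 24, 41); (40, 24, 79); (3, 24, 7); (6, 24, 11); (12, 24, 41);
      (24, 24, 53); (48, 24, 89); (30, 24, 59); (120, 24, 157); (2, 25, 5); (6, 26, 11);
      (4, 28, 7); (16, 29, 23); (2, 30, 3); (4, 32, 13); (16, 32, 53); (32, 32, 151);
      (8, 34, 11); (16, 34, 17); (96, 35, 173); (16, 38, 19); (8, 41, 13); (4, 44, 19);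
      (16, 44, 37); (6, 44, 11); (16, 47, 41); (2, 48, 3); (8, 48, 19); (16, 48, 83);
      (32, 48, 41); (112, 48, 167); (4, 50, 29)]%num.

Lemma rootless_all : all rootless_test rootless.
Proof. by vm_compute. Qed.

Definition exceptional : seq (N * N) :=
  [:: (2, 2); (2, 7); (2, 14); (2, 23); (2, 34); (2, 47); (4, 5); (4, 23)]%num.

Definition linear_test n al := (n <? 2)%num orif ex_in (fun p => slope_test p n 1 al) small_primes orif
  ex_in (fun c => let: (n', al', _) := c in (n =? n')%num andif (al =? al')%num) rootless orif
  ex_in (fun c => let: (n', al') := c in (n =? n')%num andif (al =? al')%num) exceptional.

(** A success excludes every n divisible by p^m, whatever its other prime factors, and prunes the
    search below. *)
Definition skip p m al := (0 <? m)%num andif slope_test_dvd p 1 m al.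

Lemma linear_test_all : all_from 51 0 (fun al =>
  all_from 4 0 (fun b => skip 3 b al orif all_from 3 0 (fun c => skip 5 c al orif
    all_from 3 0 (fun d => skip 7 d al orif all_from 6 0 (fun a =>
      (N.max 1 al <? 2 ^ a)%num orif linear_test (2 ^ a * 3 ^ b * 5 ^ c * 7 ^ d) al))))).
Proof. by vm_compute. Qed.

Lemma skipP p m al n : prime (nn p) -> skip p m al -> nn p ^ nn m %| n ->
  has_factor n (nn al) 1 -> False.
Proof.
move=> pp; rewrite /skip -/(_ && _) nn_lt => /andP[m0 h] qn hf.
by apply: (slope_test_dvdP pp h _ m0 qn hf).
Qed.

Theorem linear_factor_exceptional n al : has_factor n al 1 -> al <= 50 -> 1 < n ->
  (N.of_nat n, N.of_nat al) \in exceptional.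
Proof.
move=> hf al50 n1.
have [a [b [c [d [nE a6 b4 [c3 d3]]]]]] := smooth7 hf al50 (isT : 0 < 1 <= 9) (ltnW n1).
have hf' : has_factor n (nn (N.of_nat al)) 1 by rewrite Nat2N.id.
have := all_fromP linear_test_all (x := al); rewrite ltnS al50 => /(_ isT) h.
have := all_fromP h (x := b) b4; rewrite -/(_ || _) => {}h; case/orP: h => [h|h].
  by case: (skipP (isT : prime (nn 3)) h _ hf'); rewrite Nat2N.id nE -!mulnA dvdn_mull // dvdn_mulr.
have := all_fromP h (x := c) c3; rewrite -/(_ || _) => {}h; case/orP: h => [h|h].
  by case: (skipP (isT : prime (nn 5)) h _ hf'); rewrite Nat2N.id nE dvdn_mulr // dvdn_mull.
have := all_fromP h (x := d) d3; rewrite -/(_ || _) => {}h; case/orP: h => [h|h].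
  by case: (skipP (isT : prime (nn 7)) h _ hf'); rewrite Nat2N.id nE dvdn_mull.
have := all_fromP h (x := a) a6; rewrite -/(_ || _) => {}h; case/orP: h => [h|].
  (* Powers of 2 are pruned instead by 2^a <= max(1, al), the case k = 1, i = 0. *)
  have := has_factor_pow (m := a) hf (isT : prime 2) (isT : 0 < 1).
  rewrite subn0 addn0 nE -!mulnA dvdn_mulr // => /(_ isT).
  by move: h; rewrite nn_lt nnX Nat2N.id; move: (2 ^ a) => x; clear; lia.
set m := (_ * _)%num; have mE : n = nn m by rewrite nE !nnM !nnX !Nat2N.id.
rewrite mE in hf' n1 *; rewrite N2Nat.id; clear hf nE mE.
move: (N.of_nat al) hf' => {al50}al hf.
rewrite /linear_test !ex_inE -!/(_ || _) => /orP[/orP[/orP[|]|]|].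
- by move: n1; clear; lia.
- move=> /hasP[p pin hp]; case: (slope_testP _ hp hf).
  by apply: mem_prime; rewrite !mem_cat pin !orbT.
- move=> /hasP[[[n' al'] l] cin]; rewrite -!/(_ && _) => /andP[/N.eqb_eq e1 /N.eqb_eq e2].
  by have := rootless_testP (allP rootless_all _ cin); rewrite -e1 -e2 => /(_ hf).
by move=> /hasP[[n' al'] cin]; rewrite -!/(_ && _) => /andP[/N.eqb_eq -> /N.eqb_eq ->].
Qed.
End LinearFactor.

(** * Rational coefficients *)

Section RationalLaguerre.

Lemma prod_addn al n j : (j <= n)%N ->
  (\prod_(j.+1 <= i < n.+1) (i + al) * (j + al)`! = (n + al)`!)%N.
Proof.
elim: n => [|n IH]; first by rewrite leqn0 => /eqP ->; rewrite big_geq // mul1n.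
rewrite leq_eqVlt => /orP[/eqP ->|jn]; first by rewrite big_geq // mul1n.
by rewrite big_nat_recr //= mulnAC IH // mulnC addSn factS.
Qed.

Lemma lagint_laguerre n al :
  map_poly (intr : int -> rat) (lagint n al) = (n`!%:R : rat) *: laguerre n al%:Z.
Proof.
apply/polyP => j; rewrite coef_map coefZ !coef_poly ltnS.
case: leqP => [jn|_]; last by rewrite mulr0.
rewrite /= intrM intr_sign mulrC mulrA; congr (_ * _).
rewrite (eq_bigr (fun i => (i + al)%N%:R)); last by move=> i _; rewrite -PoszD -pmulrn.
rewrite -natr_prod -pmulrn mulrA.
have f0 m : m`!%:R != 0 :> rat by rewrite pnatr_eq0 -lt0n fact_gt0.
have d0 : ((n - j)`! * j`!)%N%:R != 0 :> rat by rewrite natrM mulf_neq0.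
apply: (mulIf d0); rewrite mulfVK //; apply: (mulIf (f0 (j + al)%N)).
rewrite -!natrM; congr (_%:R); have := lcoefE al jn; rewrite -(prod_addn al jn).
by move=> e; rewrite -[RHS]mulnA -[RHS]e; ring.
Qed.

Lemma size_laguerre n al : size (laguerre n al%:Z) = n.+1.
Proof.
have n0 : (n`!%:R : rat) != 0 by rewrite pnatr_eq0 -lt0n fact_gt0.
by rewrite -(size_scale _ n0) -lagint_laguerre size_map_poly_id0 ?size_lagint //
  intr_eq0 lead_coef_eq0 -size_poly_eq0 size_lagint.
Qed.

(** By Gauss's lemma a rational divisor is a scalar multiple of an integral one, and either it or
    its cofactor has degree at most n/2. *)
Lemma laguerre_irreducible n al : (0 < n)%N ->
  (forall k, (0 < k)%N -> (k.*2 <= n)%N -> ~ has_factor n al k) ->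
  irreducible_poly (laguerre n al%:Z).
Proof.
move=> n0 none; have f0 : (n`!%:R : rat) != 0 by rewrite pnatr_eq0 -lt0n fact_gt0.
split=> [|q sq qdvd]; first by rewrite size_laguerre ltnS.
rewrite -dvdp_size_eqp // size_laguerre.
have : q %| map_poly (intr : int -> rat) (lagint n al) by rewrite lagint_laguerre dvdpZr.
case/dvdpP_rat_int => G [c c0 qE] [H GH].
have sG : size q = size G.
  by rewrite qE size_scale // size_map_inj_poly //; apply: intr_inj.
rewrite sG in sq *.
have L0 : lagint n al != 0 by rewrite -size_poly_eq0 size_lagint.
have G0 : (0 < size G)%N.
  by rewrite size_poly_gt0; apply: contraNneq L0 => G0; rewrite GH G0 mul0r.
have sGE : size G = (size G).-1.+1 by rewrite prednK.
have [kn sH _] := has_factor_sizes (esym GH) sGE.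
set k := (size G).-1 in sGE kn sH; rewrite sGE eqSS.
have k0 : (0 < k)%N by rewrite lt0n; apply: contra sq => /eqP k0; rewrite sGE k0.
have [k2|k2] := leqP k.*2 n; first by case: (none k k0 k2); exists G, H.
have [//|kn'] := eqVneq k n.
case: (none (n - k)%N).
- by rewrite subn_gt0 ltn_neqAle kn' kn.
- by move: k2; rewrite -!addnn; clear; lia.
by exists H, G; rewrite mulrC GH.
Qed.

Lemma laguerre_root n al (r : int) :
  \sum_(j < n.+1) (lcoef n al j)%:Z * (- r) ^+ j = 0 ->
  'X - (r%:~R)%:P %| laguerre n al%:Z.
Proof.
move=> h; have f0 : (n`!%:R : rat) != 0 by rewrite pnatr_eq0 -lt0n fact_gt0.
rewrite dvdp_XsubCl -(rootZ _ _ f0) -lagint_laguerre /root horner_map /= intr_eq0.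
rewrite horner_poly; apply/eqP; rewrite -[RHS]h; apply: eq_bigr => j _.
by rewrite (exprNn r) mulrCA mulrA.
Qed.

Lemma lcoef_sum2 al (y : int) :
  \sum_(j < 3) (lcoef 2 al j)%:Z * y ^+ j =
  (al%:Z + 2) * (al%:Z + 1) + 2 * (al%:Z + 2) * y + y ^+ 2.
Proof.
rewrite !big_ord_recr big_ord0 /= /lcoef !ffactnS ffactn0 /= !bin0 bin1 binn.
by rewrite !PoszM !add2n /= !intS; ring.
Qed.

Lemma lcoef_sum4 al (y : int) :
  \sum_(j < 5) (lcoef 4 al j)%:Z * y ^+ j =
  (al%:Z + 4) * (al%:Z + 3) * (al%:Z + 2) * (al%:Z + 1) +
  4 * (al%:Z + 4) * (al%:Z + 3) * (al%:Z + 2) * y + 6 * (al%:Z + 4) * (al%:Z + 3) * y ^+ 2 +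
  4 * (al%:Z + 4) * y ^+ 3 + y ^+ 4.
Proof.
rewrite !big_ord_recr big_ord0 /= /lcoef !ffactnS ffactn0 /=.
rewrite (_ : 'C(4, 0) = 1)%N // (_ : 'C(4, 1) = 4)%N // (_ : 'C(4, 2) = 6)%N //.
rewrite (_ : 'C(4, 3) = 4)%N // (_ : 'C(4, 4) = 1)%N //.
rewrite !PoszM !addSn /= !intS; ring.
Qed.

Lemma exceptional_root n al : (N.of_nat n, N.of_nat al) \in exceptional ->
  exists r : int, 'X - (r%:~R)%:P %| laguerre n al%:Z.
Proof.
have conv x y : ((N.of_nat n, N.of_nat al) == (x, y)) -> n = N.to_nat x /\ al = N.to_nat y.
  by move=> /eqP[<- <-]; rewrite !Nat2N.id.
have r2 (b : nat) (r : int) : (b%:Z + 2) * (b%:Z + 1) - 2 * (b%:Z + 2) * r + r ^+ 2 = 0 ->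
    exists r : int, 'X - (r%:~R)%:P %| laguerre 2 b%:Z.
  move=> h; exists r; apply: laguerre_root; rewrite lcoef_sum2.
  by rewrite -[RHS]h sqrrN mulrN.
have r4 (b : nat) (r : int) : (b%:Z + 4) * (b%:Z + 3) * (b%:Z + 2) * (b%:Z + 1) -
    4 * (b%:Z + 4) * (b%:Z + 3) * (b%:Z + 2) * r + 6 * (b%:Z + 4) * (b%:Z + 3) * (r * r) -
    4 * (b%:Z + 4) * (r * r * r) + r * r * r * r = 0 -> exists r : int, 'X - (r%:~R)%:P %| laguerre 4 b%:Z.
  move=> h; exists r; apply: laguerre_root; rewrite lcoef_sum4.
  by rewrite -[RHS]h; ring.
rewrite !inE.
(* For n = 2 the roots are al + 2 plus or minus the square root of al + 2, a perfect square in the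
   six cases; the smaller root is given. *)
case/orP=> [/conv[-> ->]|]; first by (apply: (r2 2%N 2); lia).
case/orP=> [/conv[-> ->]|]; first by (apply: (r2 7%N 6); lia).
case/orP=> [/conv[-> ->]|]; first by (apply: (r2 14%N 12); lia).
case/orP=> [/conv[-> ->]|]; first by (apply: (r2 23%N 20); lia).
case/orP=> [/conv[-> ->]|]; first by (apply: (r2 34%N 30); lia).
case/orP=> [/conv[-> ->]|]; first by (apply: (r2 47%N 42); lia).
case/orP=> [/conv[-> ->]|]; first by (apply: (r4 5%N 6); lia).
by move=> /conv[-> ->]; apply: (r4 23%N 30); lia.
Qed.

Lemma exceptionalE n al :
  laguerre_exceptional n al%:Z <-> (N.of_nat n, N.of_nat al) \in exceptional.
Proof.
split.
  by case=> -[->]; rewrite !inE !eqz_nat => h;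
    repeat (case/orP: h => [/eqP -> //|h]); move/eqP: h => ->.
have conv x y : ((N.of_nat n, N.of_nat al) == (x, y)) -> n = N.to_nat x /\ al = N.to_nat y.
  by move=> /eqP[<- <-]; rewrite !Nat2N.id.
rewrite !inE; repeat (case/orP=> [/conv[-> ->]|]; first by [left | right]).
by move=> /conv[-> ->]; right.
Qed.
End RationalLaguerre.

Theorem theorem1 (a : int) (n : nat) :
  0 <= a <= 50 -> (1 <= n)%N ->
  (irreducible_poly (laguerre n a) <-> ~ laguerre_exceptional n a) /\
  (laguerre_exceptional n a ->
     exists q : {poly rat}, size q = 2%N /\ q %| laguerre n a).
Proof.
case: a => // al /andP[_ al50] n1; have {al50} : (al <= 50)%N by [].
move=> al50.
have root : laguerre_exceptional n al%:Z ->
    exists q : {poly rat}, size q = 2%N /\ q %| laguerre n al%:Z.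
  by move=> /exceptionalE /exceptional_root[r hr]; exists ('X - (r%:~R)%:P); rewrite size_XsubC.
split=> //; split=> [[_ irr] exc|nexc].
  (* Irreducibility would make the linear factor associate to the whole polynomial, forcing n =
     1. *)
  have [q [sq qd]] := root exc; have := irr q; rewrite sq => /(_ isT qd).
  rewrite -dvdp_size_eqp // sq size_laguerre => /eqP[n1E].
  by case: exc => -[nE _]; rewrite nE in n1E.
apply: laguerre_irreducible => // k k0 kn hf.
have [k1|k1] := leqP k 1.
  have {}k1 : k = 1%N by apply/eqP; rewrite eqn_leq k1 k0.
  rewrite k1 in hf kn; apply: nexc; apply/exceptionalE; exact: linear_factor_exceptional hf al50 kn.
have [k9|k9] := leqP k 9; first by apply: (no_small_factor hf) => //; rewrite k1 k9.
exact: no_large_factor hf al50 k9 kn.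
Qed.
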